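(* Let $P(L)$ be the number of polygons confined to the $L\times L$ square. Then, as $L\to\infty$, $$P(L)=\lambda^{L^2+O(L)} ,$$ where $\log\lambda=\lim_{L\to\infty}L^{-2}\log C(L)$ and $C(L)$ is the number of self-avoiding walks crossing the $L\times L$ square from one corner vertex to the opposite corner vertex.
   Context: For a positive integer $L$, the $L\times L$ square is the subgraph of the square lattice $\mathbb{Z}^2$ (nearest-neighbour edges) induced by the vertex set $\{0,1,\dots,L\}^2$. A self-avoiding walk is a nearest-neighbour lattice path that visits no vertex more than once. $C(L)$ is the number of self-avoiding walks that stay in the $L\times L$ square, start at a fixed corner vertex (say $(0,0)$) and end at the opposite corner vertex (say $(L,L)$). It is known from earlier work that $\lim_{L\to\infty} L^{-2}\log C(L)$ exists and is finite; $\lambda$ is defined by setting this limit equal to $\log\lambda$. A polygon is a simple closed cycle, regarded as an (unrooted, unoriented) subgraph of the lattice; $P(L)$ counts all polygons that are subgraphs of the fixed $L\times L$ square (translates are counted as different), with no requirement of having edges in the sides of the square. The notation $P(L)=\lambda^{L^2+O(L)}$ means $\log P(L)=(L^2+r(L))\log\lambda$ with $|r(L)|\le KL$ for some constant $K$ and all sufficiently large $L$. *)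

(* Defs.v *)
(* MathComp / MathComp-Analysis *)
From mathcomp Require Import all_boot all_order all_algebra.
From mathcomp Require Import all_classical all_reals all_analysis.

Set Implicit Arguments.
Unset Strict Implicit.
Unset Printing Implicit Defensive.

Import Order.TTheory GRing.Theory Num.Theory.
Import numFieldNormedType.Exports.

Local Open Scope ring_scope.

Definition lattice_adj : rel (int * int) :=
  fun u v => `|u.1 - v.1| + `|u.2 - v.2| == 1 :> int.

Definition vertex (L : nat) : finType := ('I_L.+1 * 'I_L.+1)%type.

Definition lattice_point (L : nat) (v : vertex L) : int * int :=
  ((v.1 : nat)%:Z, (v.2 : nat)%:Z).

Definition square_adj (L : nat) : rel (vertex L) :=
  relpre (@lattice_point L) lattice_adj.

Definition corner00 (L : nat) : vertex L := (ord0, ord0).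
Definition cornerLL (L : nat) : vertex L := (ord_max, ord_max).

(* The sequence p lists the vertices of the walk after its starting point
   (0, 0). Self-avoidance bounds its length by the number of vertices, so the
   bounded sequences below omit no walk. *)
Definition crossing_walks (L : nat) : {set {bseq #|vertex L| of vertex L}} :=
  [set p : {bseq #|vertex L| of vertex L} |
     [&& path (@square_adj L) (corner00 L) p,
         uniq (corner00 L :: p)
       & last (corner00 L) p == cornerLL L]].

Definition C (L : nat) : nat := #|crossing_walks L|.

Definition cycle_edges (T : finType) (c : seq T) : {set {set T}} :=
  [set [set x; next c x] | x in c].

(* A polygon is identified with its edge set, which determines the subgraph
   and forgets the root and the orientation of the cycle c. The size condition
   excludes the degenerate closed walk running back and forth along an edge. *)
Definition polygons (L : nat) : {set {set {set vertex L}}} :=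
  [set E : {set {set vertex L}} | [exists c : {bseq #|vertex L| of vertex L},
     [&& (2 < size c)%N, ucycleb (@square_adj L) c & E == cycle_edges c]]].

Definition P (L : nat) : nat := #|polygons L|.

Definition log_lambda_seq (R : realType) : R^nat :=
  fun L => ln (C L)%:R / L%:R ^+ 2.

(* The sequence converges (a known result), so limn is its actual limit and not
   a default value. The term at L = 0 is irrelevant. *)
Definition lambda (R : realType) : R := expR (limn (@log_lambda_seq R)).

(* Main.v *)
(* Write [nsaw a h] for the number of corner-to-corner self-avoiding walks in a
   box of sides [a] and [h].  Gluing two walks along an extra column gives
   [nsaw a h * nsaw b h <= nsaw (a + b + 2) h].  Conversely, cut a walk of a box by
   a vertical line: each half is a disjoint union of paths whose loose ends, the
   corner apart, lie on the cut.  Those ends can be joined inside two extra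
   columns into a single path.  Proceeding upwards, one strand [s] is kept in the
   outer column; when two further ends [p] below [q] are met, either [p] is joined
   to [q], or [p] to [s] and [q] becomes the new strand; since all degrees are at
   most 2, one of these closes no cycle.  Hence
   [nsaw (a + b + 1) h <= nsaw (a + 2) h * nsaw (b + 2) h], and the two
   inequalities together give [ln (nsaw k k) = l * k ^ 2 + O(k)].  A walk closes up to
   a polygon around the box, and a polygon opens to a walk at its leftmost lowest
   vertex, so [P] is compared with [nsaw] in boxes whose sides differ by O(1). *)
Require Import Defs.
From mathcomp Require Import all_boot all_algebra zify boolp.

Set Implicit Arguments.
Unset Strict Implicit.
Unset Printing Implicit Defensive.

(** * Acyclic edge lists *)

Section EdgeLists.
Variable V : eqType.
Implicit Types (E F : seq (V * V)) (e : V * V) (b : pred (V * V)) (u v w s t : V).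

Definition mult e v : nat := (e.1 == v) + (e.2 == v).

Definition deg E v : nat := sumn [seq mult e v | e <- E].

(** The cycle space modulo 2 is trivial. For a list without repeated pairs this says that the edges
    form a forest; parity counts then replace the handling of explicit cycles. *)
Definition acyclic E : Prop :=
  forall b, (forall v, ~~ odd (deg (filter b E) v)) -> filter b E = [::].

Definition linked E u v := ((u, v) \in E) || ((v, u) \in E).

Lemma deg_cat E F v : deg (E ++ F) v = deg E v + deg F v.
Proof. by rewrite /deg map_cat sumn_cat. Qed.

Lemma deg_cons e E v : deg (e :: E) v = mult e v + deg E v.
Proof. by []. Qed.

Lemma deg_filterC b E v : deg E v = deg (filter b E) v + deg (filter (predC b) E) v.
Proof. by elim: E => //= e E; rewrite !deg_cons; case: (b e) => /=; rewrite deg_cons; lia. Qed.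

Lemma deg_filter_le b E v : deg (filter b E) v <= deg E v.
Proof. by rewrite (deg_filterC b E v) leq_addr. Qed.

Lemma deg_gt0P E v : reflect (exists2 e, e \in E & (e.1 == v) || (e.2 == v)) (0 < deg E v).
Proof.
elim: E => [|e E IH]; first by constructor; case.
rewrite deg_cons /mult; case: (boolP ((e.1 == v) || (e.2 == v))) => He.
  have -> : 0 < (e.1 == v) + (e.2 == v) + deg E v by move: He; do 2! case: (_ == _).
  by constructor; exists e; rewrite ?mem_head.
have -> : (e.1 == v) + (e.2 == v) + deg E v = deg E v by move: He; do 2! case: (_ == _).
apply: (iffP IH) => -[f Hf Hfv]; exists f => //; first by rewrite inE Hf orbT.
by move: Hf; rewrite inE => /orP[/eqP fe|//]; move: He; rewrite -fe Hfv.
Qed.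

Lemma deg_eq0 E v : (forall e, e \in E -> e.1 != v /\ e.2 != v) -> deg E v = 0.
Proof.
move=> H; apply/eqP; rewrite -leqn0 leqNgt; apply/negP => /deg_gt0P [e /H[]].
by move=> /negPf-> /negPf->.
Qed.

Lemma eq_deg_filter b E v :
  (forall e, e \in E -> (e.1 == v) || (e.2 == v) -> b e) -> deg (filter b E) v = deg E v.
Proof.
move=> H; rewrite [RHS](deg_filterC b) (_ : deg (filter (predC b) E) v = 0) ?addn0 //.
apply/deg_eq0 => e; rewrite mem_filter => /andP[/= Hb He].
by apply/andP; rewrite -negb_or; apply: contra Hb => /(H _ He).
Qed.

Lemma deg_filterI b b' E v : deg (filter b E) v = deg E v ->
  deg (filter (predI b b') E) v = deg (filter b' E) v.
Proof.
move=> H; have H0 : deg (filter (predC b) E) v = 0.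
  by move: (deg_filterC b E v); rewrite H; lia.
rewrite [RHS](deg_filterC b) -!filter_predI.
suff -> : deg (filter (predI (predC b) b') E) v = 0 by rewrite addn0.
have := deg_filter_le b' (filter (predC b) E) v.
rewrite H0 leqn0 -filter_predI => /eqP <-; congr deg.
by apply: eq_filter => e /=; rewrite andbC.
Qed.

Lemma sum_deg (vs : seq V) E : uniq vs ->
  (forall e, e \in E -> (e.1 \in vs) && (e.2 \in vs)) -> sumn [seq deg E v | v <- vs] =
    (size E).*2.
Proof.
move=> Uvs; elim: E => [|e E IH] H /=.
  by rewrite /deg /=; elim: (vs).
have /andP[H1 H2] := H e (mem_head _ _).
have sum1 x : x \in vs -> sumn [seq (x == v : nat) | v <- vs] = 1.
  move=> Hx; rewrite (eq_map (g := fun v => (pred1 x v : nat))); last by move=> v /=;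
    rewrite eq_sym.
  by rewrite sumn_count; apply/eqP; rewrite count_uniq_mem ?Hx.
have -> : sumn [seq deg (e :: E) v | v <- vs] =
  sumn [seq (e.1 == v : nat) | v <- vs] + sumn [seq (e.2 == v : nat) | v <- vs] +
    sumn [seq deg E v | v <- vs].
  by elim: (vs) => //= v l ->; rewrite deg_cons /mult; lia.
rewrite !sum1 // IH ?doubleS // => f Hf; apply: H; by rewrite inE Hf orbT.
Qed.

(** Handshake lemma, summed over all vertices that occur in [E] or in [os]. It later yields
    contradictions, when the odd vertices are one or three listed points. *)
Lemma even_odd_vertices E (os : seq V) : uniq os ->
  (forall v, odd (deg E v) = (v \in os)) -> ~~ odd (size os).
Proof.
move=> Uos H; pose vs := undup (os ++ map fst E ++ map snd E).
have Hs : odd (sumn [seq deg E v | v <- vs]) = false.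
  rewrite sum_deg ?undup_uniq ?odd_double // => e He.
  by rewrite !mem_undup !mem_cat !(map_f _ He) !orbT.
suff -> : size os = count (fun v => odd (deg E v)) vs.
  suff -> : odd (count (fun v =>
    odd (deg E v)) vs) = odd (sumn [seq deg E v | v <- vs]) by rewrite Hs.
  by elim: (vs) => //= v l IH; rewrite !oddD IH oddb.
rewrite (eq_count H) -size_filter; apply/perm_size/uniq_perm => //.
  by rewrite filter_uniq // undup_uniq.
by move=> v; rewrite mem_filter mem_undup mem_cat; case: (v \in os).
Qed.

Lemma acyclic_filter b E : acyclic E -> acyclic (filter b E).
Proof. by move=> aE b'; rewrite -filter_predI => /aE. Qed.

Lemma acyclic_nil E : acyclic E -> (forall v, ~~ odd (deg E v)) -> E = [::].
Proof. by move=> /(_ predT); rewrite filter_predT. Qed.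

(** In any sub-list that contains the new edge, the fresh vertex [v] has degree 1. *)
Lemma acyclic_pendant E u v : acyclic E -> u != v -> deg E v = 0 -> acyclic ((u, v) :: E).
Proof.
move=> aE uv dv b /= Hb.
have Hbuv : b (u, v) = false.
  apply/negP => H; move: (Hb v); rewrite H deg_cons /mult /= (negPf uv) eqxx.
  have := deg_filter_le b E v; rewrite dv leqn0 => /eqP ->; done.
by move: Hb; rewrite Hbuv => /aE.
Qed.

(** A nonempty even sub-list must use the new edge, because [E] is acyclic. What remains of it
    without that edge is odd exactly at the two ends. *)
Lemma not_acyclic_cons E u v : acyclic E -> u != v -> ~ acyclic ((u, v) :: E) ->
  exists b, forall w, odd (deg (filter b E) w) = ((w == u) || (w == v)).
Proof.
move=> aE uv /existsNP [b] /not_implyP [/=].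
case: ifP => [buv Hb _|_ Hb []]; last exact: aE.
exists b => w; move: (Hb w); rewrite deg_cons /mult /= oddD negb_add => /eqP <-.
rewrite (eq_sym w u) (eq_sym w v); move: uv.
case: (u =P w) => [->|_ _]; last by case: (v == w).
by case: (v =P w) => [->|_]; rewrite ?eqxx.
Qed.

(* If adding either edge closed a cycle, the two sub-edge-sets of [E] joining
   [p] to [q] and [p] to [a] would meet in a set whose only odd vertex is [p]. *)
Lemma acyclic_choice E p q a : acyclic E -> (forall v, deg E v <= 2) ->
  deg E p = 1 -> deg E q = 1 -> deg E a = 1 -> uniq [:: p; q; a] ->
  acyclic ((p, q) :: E) \/ acyclic ((p, a) :: E).
Proof.
move=> aE d2 dp dq da /= /and3P[]; rewrite !inE negb_or => /andP[pq pa] qa _.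
case: (pselect (acyclic ((p, q) :: E))) => [|/(not_acyclic_cons aE pq)[b1 H1]]; first by left.
case: (pselect (acyclic ((p, a) :: E))) => [|/(not_acyclic_cons aE pa)[b2 H2]]; first by right.
suff : ~~ odd (size [:: p]) by [].
apply: (@even_odd_vertices (filter (predI b1 b2) E)) => // v; rewrite inE.
have L1 := deg_filter_le b1 E v; have L2 := deg_filter_le b2 E v.
have L12 : deg (filter (predI b1 b2) E) v <= deg (filter b2 E) v.
  rewrite (_ : filter (predI b1 b2) E = filter b1 (filter b2 E)) ?deg_filter_le //.
  by rewrite filter_predI.
have L21 : deg (filter (predI b1 b2) E) v <= deg (filter b1 E) v.
  rewrite (_ : filter (predI b1 b2) E = filter b2 (filter b1 E)) ?deg_filter_le //.
  by rewrite -filter_predI; apply: eq_filter => e /=; rewrite andbC.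
have K := @deg_filterI b1 b2 E v.
move: (H1 v) (H2 v) (d2 v).
(* At [p] both sub-lists contain its single edge. At [q] the second, and at [a] the first, has even
   degree at most 1, hence 0. Elsewhere the first sub-list contains no edge at [v] or all of them,
   so the intersection has degree 0 or the even degree of the second. *)
have [Evp|vp] := eqVneq v p => /=.
  subst v; by move=> O1 O2 _; rewrite K ?O2 //; move: (deg_filter_le b1 E p) O1; rewrite dp;
    case: (deg _ _) => [|[|]].
have [vq|vq] := eqVneq v q => /=.
  rewrite vq (negPf qa) => _ O2 _; move: L2 L12; rewrite vq dq; move: O2.
  by case: (deg (filter b2 E) q) => [|[|]] //= _ _; rewrite leqn0 => /eqP ->.
have [va|va] := eqVneq v a => /=.
  rewrite va => O1 _ _; move: L1 L21; rewrite va da; move: O1.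
  by case: (deg (filter b1 E) a) => [|[|]] //= _ _; rewrite leqn0 => /eqP ->.
move=> O1 O2 d; case E1: (deg (filter b1 E) v) L1 L21 O1 => [|[|[|]]] //.
- by rewrite leqn0 => _ /eqP ->.
- move=> L _ _; rewrite K ?O2 // E1; lia.
- move=> L; lia.
Qed.

(** * Self-avoiding walks as edge lists *)

Lemma deg1_edge E s : deg E s = 1 ->
  exists2 e, [seq f <- E | (f.1 == s) || (f.2 == s)] = [:: e] & mult e s = 1.
Proof.
pose b := fun f : V * V => (f.1 == s) || (f.2 == s); rewrite -/b -(@eq_deg_filter b) //.
have : all b (filter b E) by apply: filter_all.
case: (filter b E) => [|e [|f F]] //=.
  by rewrite /deg /= addn0 => _ H; exists e.
by rewrite !deg_cons /b /mult => /and3P[]; do 4! case: (_ == _) => //=.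
Qed.

Definition pedges s p := pairmap (@pair V V) s p.

Lemma pedges_mem s p e : e \in pedges s p -> (e.1 \in s :: p) && (e.2 \in p).
Proof.
elim: p s => //= x p IH s; rewrite inE => /orP[/eqP ->|/IH/andP[H1 H2]].
  by rewrite !inE !eqxx.
by move: H1; rewrite !inE H2 => ->; rewrite !orbT.
Qed.

Lemma deg_pedges_notin s p v : v \notin s :: p -> deg (pedges s p) v = 0.
Proof.
move=> H; apply/deg_eq0 => e /pedges_mem/andP[H1 H2]; split; apply: contra H => /eqP <- //.
by rewrite inE H2 orbT.
Qed.

Lemma deg_pedges s p v : uniq (s :: p) ->
  deg (pedges s p) v = if v \in s :: p then (v != s) + (v != last s p) else 0.
Proof.
case: ifP => [|/negbT /deg_pedges_notin //].
elim: p s => [|x p IH] s.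
  by rewrite /= inE => /eqP -> _; rewrite eqxx.
rewrite inE => Hv; rewrite [uniq _]/= => /andP[Hs Hu].
rewrite [pedges _ _]/= deg_cons /mult /=.
have [Evs|vs] := eqVneq v s.
  rewrite Evs deg_pedges_notin // (_ : x == s = false).
    have -> : (s != last x p) by apply: contra Hs => /eqP->; apply: mem_last.
    by [].
  by apply/negP => /eqP xs; rewrite xs mem_head in Hs.
have Hvx : v \in x :: p by case/orP: Hv => // /eqP H; rewrite H eqxx in vs.
rewrite (IH _ Hvx Hu) (eq_sym x); by case: (v == x).
Qed.

(** The first edge is the only one at the starting vertex, so no even sub-list uses it; induction
    along the walk does the rest. *)
Lemma acyclic_pedges s p : uniq (s :: p) -> acyclic (pedges s p).
Proof.
elim: p s => [|x p IH] s; first by move=> _ b.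
rewrite [uniq _]/= => /andP[Hs Hu] /= b /= Hb.
have sx : (x == s) = false by apply/negP => /eqP xs; rewrite xs mem_head in Hs.
have Hbs : b (s, x) = false.
  apply/negP => H; move: (Hb s); rewrite H deg_cons /mult /= eqxx sx.
  by have := deg_filter_le b (pedges x p) s; rewrite deg_pedges_notin // leqn0 => /eqP ->.
by move: Hb; rewrite Hbs => /(IH _ Hu).
Qed.

(** The vertex after [s] is the only one linked to [s]; with [s] deleted the argument repeats.
    Injectivity of cutting a walk, and of closing it to a polygon, is tested on unoriented edges
    through this fact. *)
Lemma pedges_inj s p q : uniq (s :: p) -> uniq (s :: q) ->
  linked (pedges s p) =2 linked (pedges s q) -> p = q.
Proof.
elim: p s q => [|x p IH] s [|y q] //; rewrite ?[uniq _]/=.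
- by move=> _ _ /(_ s y); rewrite /linked /= mem_head.
- by move=> _ _ /(_ s x); rewrite /linked /= mem_head.
move=> /andP[Hs Hup] /andP[Hs' Huq] H.
have lnk z r u : s \notin z :: r -> linked (pedges s (z :: r)) s u = (u == z).
  move=> Hz; rewrite /linked /= !inE !xpair_eqE eqxx /=.
  have N1 : (s, u) \in pedges z r = false.
    by apply: contraNF Hz => /pedges_mem/andP[].
  have N2 : (u, s) \in pedges z r = false.
    by apply: contraNF Hz => /pedges_mem/andP[_ /=]; rewrite inE orbC => ->.
  have N3 : s == z = false by apply: contraNF Hz => /eqP ->; apply: mem_head.
  by rewrite -/(pedges z r) N1 N2 N3 andbF !orbF.
have xy : x = y by apply/eqP; rewrite -(lnk y q) // -H lnk.
subst y; congr cons; apply: (IH x) => // u v.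
have lnk2 r : s \notin x :: r -> linked (pedges x r) u v =
    [&& u != s, v != s & linked (pedges s (x :: r)) u v].
  move=> Hr; have [->|us] := eqVneq u s => /=.
    apply/negbTE; apply: contra Hr => /orP[/pedges_mem/andP[]//|/pedges_mem/andP[_ /=]].
    by rewrite inE orbC => ->.
  have [->|vs] := eqVneq v s => /=.
    apply/negbTE; apply: contra Hr => /orP[/pedges_mem/andP[_ /=]|/pedges_mem/andP[]//].
    by rewrite inE orbC => ->.
  by rewrite /linked /= !inE !xpair_eqE (negPf us) (negPf vs).
by rewrite !lnk2 // H.
Qed.

(** The edge at [s] is stripped off and its other end [u] becomes the new start: if [u] is not [t],
    its degree was 2 and is now 1. *)
Lemma walk_of_edges E s t : acyclic E -> s != t -> deg E s = 1 -> deg E t = 1 ->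
  (forall v, v != s -> v != t -> ~~ odd (deg E v) /\ deg E v <= 2) ->
  exists p, [/\ uniq (s :: p), last s p = t & linked (pedges s p) =2 linked E].
Proof.
have [n] := ubnP (size E); elim: n E s => // n IH E s; rewrite ltnS => En aE st ds dt dv.
have [e He es] := deg1_edge ds.
pose F := [seq f <- E | ~~ ((f.1 == s) || (f.2 == s))].
have [u Hu Heu] : exists2 u, u != s & e = (s, u) \/ e = (u, s).
  case: e es {He} => x y; rewrite /mult /=.
  have [->|xs] := eqVneq x s; have [->|ys] := eqVneq y s => //= _; first by exists y => //; left.
  by exists x => //; right.
have dE v : deg E v = (v == s) + (v == u) + deg F v.
  rewrite (deg_filterC (fun f : V * V => (f.1 == s) || (f.2 == s))) He /deg /= addn0;
    congr (_ + _).
  by case: Heu => -> /=; rewrite /mult /= (eq_sym s) (eq_sym u) // addnC.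
have lnkE v w : linked E v w = linked F v w || ((v == s) && (w == u) || (v == u) && (w == s)).
  have memE f : f \in E = (f \in F) || (f == e).
    rewrite /F mem_filter; have := mem_filter (fun f : V * V => (f.1 == s) || (f.2 == s)) f E.
    by rewrite He inE => -> /=; case: (f \in E); case: (f.1 == s); case: (f.2 == s).
  rewrite /linked !memE; case: Heu => ->; rewrite !xpair_eqE;
  by case: (_ \in F); case: (_ \in F); do 4! case: (_ == _).
have aF : acyclic F by apply: acyclic_filter.
have sF : size F < n.
  apply: leq_trans En; rewrite -(count_predC (fun f : V * V => (f.1 == s) || (f.2 == s)) E).
  by rewrite -!size_filter He.
have Fs : deg F s = 0 by move: (dE s); rewrite ds eqxx; lia.
have [Eut|ut] := eqVneq u t.
  (* Once [t] is reached all remaining degrees are even, so acyclicity excludes any further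
     component. *)
  have F0 : F = [::].
    apply: acyclic_nil => // v; have [->|vs] := eqVneq v s; first by rewrite Fs.
    have [Evt|vt] := eqVneq v t.
      by rewrite Evt; move: (dE t); rewrite dt Eut eqxx; case: (deg F t) => //; lia.
    have [+ _] := dv v vs vt; rewrite dE (negPf vs) Eut (negPf vt); done.
  exists [:: t]; split => //=; first by rewrite inE st.
  move=> v w; rewrite lnkE F0 /linked /= !inE !xpair_eqE Eut; do 4! case: (_ == _) => //=.
have du : deg F u = 1.
  have [Ho H2] := dv u Hu ut; move: Ho H2; rewrite dE eqxx (negPf Hu) add0n /= add1n.
  by case: (deg F u) => [|[|]].
have dFt : deg F t = 1.
  by move: (dE t); rewrite dt (eq_sym t) (negPf st) (eq_sym t) (negPf ut).
have [|p [Up Lp Kp]] := IH F u sF aF ut du dFt.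
  move=> v vu vt; have [->|vs] := eqVneq v s; first by rewrite Fs.
  by have := dv v vs vt; rewrite dE (negPf vs) (negPf vu).
exists (u :: p); split => //=.
- rewrite [uniq _ ]/= in Up; rewrite inE (eq_sym s) (negPf Hu) /= Up andbT; apply/negP => sp.
  have : 0 < deg F s.
    have : 0 < deg (pedges u p) s.
      by rewrite deg_pedges // inE sp orbT (eq_sym s) Hu.
    move=> /deg_gt0P[[x y] He' /= Hxy]; have : linked F x y by rewrite -Kp /linked He'.
    by case/orP => H; apply/deg_gt0P; [exists (x, y)|exists (y, x)] => //=; rewrite orbC.
  by rewrite Fs.
- move=> v w; rewrite lnkE -Kp /linked /= !inE !xpair_eqE.
  do 2! case: (_ \in pairmap _ _ _); do 4! case: (_ == _) => //=.
Qed.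

End EdgeLists.

(** * Cutting a walk *)

Section PathEdges.
Variable V : eqType.
Implicit Types (s u v : V) (p : seq V).

Lemma path_pedges (r : rel V) s p : path r s p = all (fun e => r e.1 e.2) (pedges s p).
Proof. by elim: p s => //= x p IH s; rewrite IH. Qed.

Lemma mem_pedges_last s p v : v \in p -> exists u, (u, v) \in pedges s p.
Proof.
elim: p s => //= x p IH s; rewrite inE => /orP[/eqP ->|/(IH x)[u Hu]].
  by exists s; rewrite mem_head.
by exists u; rewrite inE Hu orbT.
Qed.

End PathEdges.

Definition point := (nat * nat)%type.

Definition adjn (u v : point) : bool :=
  (u.1 == v.1) && ((u.2.+1 == v.2) || (v.2.+1 == u.2)) ||
  (u.2 == v.2) && ((u.1.+1 == v.1) || (v.1.+1 == u.1)).

(** Coordinates are natural numbers, so the left and bottom sides of the box need no condition. *)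
Definition inbox a h (v : point) := (v.1 <= a) && (v.2 <= h).

Definition origin : point := (0, 0).

Definition saw a h (p : seq point) :=
  [&& path adjn origin p, uniq (origin :: p), last origin p == (a, h) & all (inbox a h) p].

Lemma adjn_sym : symmetric adjn.
Proof. by move=> [x y] [x' y']; rewrite /adjn /=; lia. Qed.

(** * Joining the loose ends row by row *)

Section RowByRow.

(* [El] is the part of a walk to the left of the cut; its loose ends lie in
   column [a + 1].  They are joined within columns [a + 1] and [a + 2]. *)
Variables (a h : nat) (El : seq (point * point)).
Hypothesis acyclic_El : acyclic El.
Hypothesis deg_El : forall v, deg El v <= 2.
Hypothesis El_adj : forall e, e \in El ->
  [/\ adjn e.1 e.2, (e.1.1 <= a) || (e.2.1 <= a), inbox a.+1 h e.1 & inbox a.+1 h e.2].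
Hypothesis deg_El_col : forall y, deg El (a.+1, y) <= 1.

Definition even2 d := (d <= 2) && (d != 1).

(* The number [st] of loose ends after the rows below [k] have been treated:
   one in column [a + 2] if [st > 0], and another in column [a + 1] if [st = 2]. *)
Definition frontier k st (G : seq (point * point)) : Prop :=
  [/\ acyclic G,
      exists2 X, G = X ++ El & forall e, e \in X ->
        [/\ adjn e.1 e.2, a < e.1.1 <= a.+2, a < e.2.1 <= a.+2 & (e.1.2 < k) && (e.2.2 < k)],
      st <= 2 /\ (k = 0 -> st = 0),
      (forall y, y.+1 < k -> even2 (deg G (a.+1, y)) /\ even2 (deg G (a.+2, y)))
    & forall y, y.+1 = k -> deg G (a.+2, y) = (0 < st) /\
        (if st == 2 then deg G (a.+1, y) == 1 else even2 (deg G (a.+1, y)))].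

Lemma deg_El_out v : a.+1 < v.1 \/ h < v.2 -> deg El v = 0.
Proof.
move=> Hv; apply/deg_eq0 => e /El_adj[_ _]; rewrite /inbox => /andP[H1 H2] /andP[H3 H4].
by split; apply/negP => /eqP E; move: Hv; rewrite -E; lia.
Qed.

Lemma frontier_deg k st G v : frontier k st G -> (v.1 <= a) || (k <= v.2) || (a.+2 < v.1) ->
  deg G v = deg El v.
Proof.
case: v => x y [_ [X -> HX] _ _ _] /= Hv; rewrite deg_cat [deg X _]deg_eq0 //.
move=> [[x1 y1] [x2 y2]] /HX[_ /=] H1 H2 H3.
by rewrite !xpair_eqE; split; lia.
Qed.

Lemma frontier_deg2 k st G v : frontier k st G -> deg G v <= 2.
Proof.
move=> HG; have [/(frontier_deg HG) ->|] := boolP ((v.1 <= a) || (k <= v.2) || (a.+2 < v.1));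
  first exact: deg_El.
case: v => x y; rewrite /= => Hv; case: HG => _ _ [Hst _] H1 H2.
have Hx : x = a.+1 \/ x = a.+2 by lia.
have [/H1|Hy] := boolP (y.+1 < k); first by rewrite /even2; case: Hx => ->; lia.
have /H2 : y.+1 = k by lia.
by rewrite /even2; case: Hx => -> []; case: (st == 2); lia.
Qed.

(** Row [k] brings at most one new loose end of [El], at [(a + 1, k)], while column [a + 2] is still
    free there. The cases are whether that end exists and how many strands arrive from below. *)
Lemma frontier_step k st G : k <= h -> frontier k st G ->
  exists st' G', frontier k.+1 st' G'.
Proof.
move=> kh HG; have d2 v := frontier_deg2 v HG.
have dk v : k <= v.2 -> deg G v = deg El v.
  by move=> Hv; apply: (frontier_deg HG); rewrite Hv orbT.
have dk1 : deg G (a.+1, k) <= 1 by rewrite dk.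
have dk2 : deg G (a.+2, k) = 0 by rewrite dk // deg_El_out //=; left.
have dk1' y : k < y -> deg G (a.+1, y) = deg El (a.+1, y) by move=> H; rewrite dk //= ltnW.
have [aG [X EG HX] [st2 st0] H1 H2] := HG.
have HX' X' : (forall e, e \in X' -> [/\ adjn e.1 e.2, a < e.1.1 <= a.+2, a < e.2.1 <= a.+2
  & (e.1.2 < k.+1) && (e.2.2 < k.+1)]) ->
   exists2 Y, X' ++ G = Y ++ El & forall e, e \in Y ->
        [/\ adjn e.1 e.2, a < e.1.1 <= a.+2, a < e.2.1 <= a.+2
          & (e.1.2 < k.+1) && (e.2.2 < k.+1)].
  move=> H; exists (X' ++ X); first by rewrite EG catA.
  by move=> e; rewrite mem_cat => /orP[/H//|/HX[? ? ? ?]]; split=> //; lia.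
have [q0|q1] : deg G (a.+1, k) = 0 \/ deg G (a.+1, k) = 1 by lia.
(* No new end: every strand is prolonged upwards in its own column. *)
- have [Est|[Est|Est]] : st = 0 \/ st = 1 \/ st = 2 by lia.
  + exists 0, G; split => //; first by apply: (HX' [::]).
      move=> y Hy; have [/H1 //|Hy'] := boolP (y.+1 < k).
      by have /H2 : y.+1 = k; [lia|rewrite Est /even2 /=; lia].
    by move=> y [->]; rewrite dk2 /= /even2 q0.
  (* Since [st] is positive, [st0] excludes [k = 0], and there is a row [y] just below. *)
  + have [y Ey] : exists y, y.+1 = k by exists k.-1; lia.
    have [D1 D2] := H2 _ Ey; rewrite Est /= in D1 D2.
    exists 1, (((a.+2, y), (a.+2, k)) :: G); split => //.
    * by apply: acyclic_pendant; rewrite // ?xpair_eqE; lia.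
    * by apply: (HX' [:: _]) => e; rewrite inE => /eqP -> /=; split; rewrite /adjn /=; lia.
    * move=> z Hz; rewrite !deg_cons /mult /= !xpair_eqE.
      have [zk|Hz'] := boolP (z.+1 < k); first by move: (H1 _ zk); rewrite /even2; lia.
      have -> : z = y by lia.
      by move: D2; rewrite /even2; lia.
    * move=> z [->]; rewrite !deg_cons /mult /= !xpair_eqE /even2; lia.
  + have [y Ey] : exists y, y.+1 = k by exists k.-1; lia.
    have [D1 D2] := H2 _ Ey; rewrite Est /= in D1 D2.
    exists 2, (((a.+2, y), (a.+2, k)) :: ((a.+1, y), (a.+1, k)) :: G); split => //.
    * apply: acyclic_pendant; rewrite // ?deg_cons /mult /= ?xpair_eqE; [|lia..].
      by apply: acyclic_pendant; rewrite // ?xpair_eqE; lia.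
    * by apply: (HX' [:: _; _]) => e; rewrite !inE => /orP[]/eqP -> /=; split; rewrite /adjn /=;
      lia.
    * move=> z Hz; rewrite !deg_cons /mult /= !xpair_eqE.
      have [zk|Hz'] := boolP (z.+1 < k); first by move: (H1 _ zk); rewrite /even2; lia.
      have -> : z = y by lia.
      by move: D2; rewrite /even2; lia.
    * move=> z [->]; rewrite !deg_cons /mult /= !xpair_eqE; lia.
have [Est|[Est|Est]] : st = 0 \/ st = 1 \/ st = 2 by lia.
(* The new end moves out to column [a + 2] and becomes the outer strand. *)
- exists 1, (((a.+1, k), (a.+2, k)) :: G); split => //.
  + by apply: acyclic_pendant; rewrite // ?xpair_eqE; lia.
  + by apply: (HX' [:: _]) => e; rewrite inE => /eqP -> /=; split; rewrite /adjn /=; lia.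
  + move=> z Hz; rewrite !deg_cons /mult /= !xpair_eqE.
    have [zk|Hz'] := boolP (z.+1 < k); first by move: (H1 _ zk); rewrite /even2; lia.
    by have /H2 : z.+1 = k; [lia|rewrite Est /even2 /=; lia].
  + move=> z [->]; rewrite !deg_cons /mult /= !xpair_eqE /even2; lia.
(* The outer strand goes up; the new end stays in column [a + 1] as the second one. *)
- have [y Ey] : exists y, y.+1 = k by exists k.-1; lia.
  have [D1 D2] := H2 _ Ey; rewrite Est /= in D1 D2.
  exists 2, (((a.+2, y), (a.+2, k)) :: G); split => //.
  + by apply: acyclic_pendant; rewrite // ?xpair_eqE; lia.
  + by apply: (HX' [:: _]) => e; rewrite inE => /eqP -> /=; split; rewrite /adjn /=; lia.
  + move=> z Hz; rewrite !deg_cons /mult /= !xpair_eqE.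
    have [zk|Hz'] := boolP (z.+1 < k); first by move: (H1 _ zk); rewrite /even2; lia.
    have -> : z = y by lia.
    by move: D2; rewrite /even2; lia.
  + move=> z [->]; rewrite !deg_cons /mult /= !xpair_eqE; lia.
have [y Ey] : exists y, y.+1 = k by exists k.-1; lia.
have [D1 D2] := H2 _ Ey; rewrite Est /= in D1 D2.
(* Three ends meet. Either the waiting end [(a + 1, y)] is joined vertically to the new one and the
   outer strand goes up, or it is joined horizontally to the outer strand and the new end moves out
   in its place. *)
have [] := @acyclic_choice _ G (a.+1, y) (a.+1, k) (a.+2, y) aG d2 (eqP D2) q1 D1.
- by rewrite /= !inE !xpair_eqE; lia.
- move=> aG'; exists 1, (((a.+2, y), (a.+2, k)) :: ((a.+1, y), (a.+1, k)) :: G); split => //.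
  + by apply: acyclic_pendant; rewrite // ?deg_cons /mult /= ?xpair_eqE; lia.
  + by apply: (HX' [:: _; _]) => e; rewrite !inE => /orP[]/eqP -> /=; split; rewrite /adjn /=;
    lia.
  + move=> z Hz; rewrite !deg_cons /mult /= !xpair_eqE.
    have [zk|Hz'] := boolP (z.+1 < k); first by move: (H1 _ zk); rewrite /even2; lia.
    have -> : z = y by lia.
    by move: D2; rewrite /even2; lia.
  + move=> z [->]; rewrite !deg_cons /mult /= !xpair_eqE /even2; lia.
- move=> aG'; exists 1, (((a.+1, k), (a.+2, k)) :: ((a.+1, y), (a.+2, y)) :: G); split => //.
  + by apply: acyclic_pendant; rewrite // ?deg_cons /mult /= ?xpair_eqE; lia.
  + by apply: (HX' [:: _; _]) => e; rewrite !inE => /orP[]/eqP -> /=; split; rewrite /adjn /=;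
    lia.
  + move=> z Hz; rewrite !deg_cons /mult /= !xpair_eqE.
    have [zk|Hz'] := boolP (z.+1 < k); first by move: (H1 _ zk); rewrite /even2; lia.
    have -> : z = y by lia.
    by move: D2; rewrite /even2; lia.
  + move=> z [->]; rewrite !deg_cons /mult /= !xpair_eqE /even2; lia.
Qed.

Lemma frontier_exists k : k <= h.+1 -> exists st G, frontier k st G.
Proof.
elim: k => [_|k IH Hk]; last by have [st [G HG]] := IH (ltnW Hk); apply: frontier_step HG.
by exists 0, El; split => //; exists [::].
Qed.

Hypothesis deg_origin : deg El origin = 1.
Hypothesis deg_inner : forall v, v.1 <= a -> v != origin -> even2 (deg El v).

(** After the top row every degree is 0 or 2 except at the origin and possibly at the tops of the
    two extra columns. The new edges avoid columns up to [a], so the links there are those of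
    [El]. *)
Lemma completion : exists2 q, saw a.+2 h q &
  forall u v, (u.1 <= a) || (v.1 <= a) -> linked (pedges origin q) u v = linked El u v.
Proof.
have [st [G HG]] := frontier_exists (leqnn h.+1).
have [aG [X EG HX] [st2 _] H1 H2] := HG.
have [D2 D1] := H2 h erefl.
have even_out v : v != origin -> v != (a.+1, h) -> v != (a.+2, h) -> even2 (deg G v).
  case: v => x y N0 N1 N2.
  have [xa|xa] := leqP x a.
    by rewrite (frontier_deg HG) ?deg_inner //= xa.
  have [xa2|xa2] := ltnP a.+2 x.
    by rewrite (frontier_deg HG) /= ?deg_El_out //= ?xa2 ?orbT //; left; lia.
  have [hy|hy] := ltnP h y.
    by rewrite (frontier_deg HG) /= ?deg_El_out //= ?hy ?orbT //; right.
  have [/H1[] |yh] := boolP (y.+1 < h.+1).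
    by have [->|->] : x = a.+1 \/ x = a.+2 by lia.
  by move: N1 N2; rewrite !xpair_eqE; lia.
have even2_odd d : even2 d -> odd d = false by rewrite /even2; lia.
have dor : deg G origin = 1 by rewrite (frontier_deg HG).
(* With [st] equal to 0 or 2 there would be one or three odd vertices. The single end left is
   therefore the corner [(a + 2, h)]. *)
have Est : st = 1.
  have [Est|[//|Est]] : st = 0 \/ st = 1 \/ st = 2 by lia.
  - suff : ~~ odd (size [:: origin]) by [].
    apply: (@even_odd_vertices _ G) => // v; rewrite inE.
    have [->|N0] := eqVneq v origin; first by rewrite dor.
    apply: even2_odd.
    have [->|N1] := eqVneq v (a.+1, h); first by rewrite Est in D1.
    have [->|N2] := eqVneq v (a.+2, h); first by rewrite D2 Est.
    exact: even_out.
  - suff : ~~ odd (size [:: origin; (a.+1, h); (a.+2, h)]) by [].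
    apply: (@even_odd_vertices _ G) => [|v]; first by rewrite /= !inE !xpair_eqE; lia.
    rewrite !inE.
    have [->|N0] := eqVneq v origin; first by rewrite dor.
    have [->|N1] := eqVneq v (a.+1, h); first by rewrite Est in D1; rewrite (eqP D1).
    have [->|N2] := eqVneq v (a.+2, h); first by rewrite D2 Est.
    exact/even2_odd/even_out.
rewrite Est /= in D1 D2.
have [|v N0 N2|q [Uq Lq Kq]] := @walk_of_edges _ G origin (a.+2, h) aG _ dor D2 => //.
  have : even2 (deg G v) by have [->//|N1] := eqVneq v (a.+1, h); apply: even_out.
  by rewrite /even2; lia.
have GX e : e \in G -> [/\ adjn e.1 e.2, inbox a.+2 h e.1 & inbox a.+2 h e.2].
  rewrite EG mem_cat => /orP[/HX|/El_adj] []; case: e => [[x1 y1] [x2 y2]];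
  by rewrite /inbox /= => A B C D; split => //; lia.
have qG u v : (u, v) \in pedges origin q -> [/\ adjn u v, inbox a.+2 h u & inbox a.+2 h v].
  move=> Huv; have : linked G u v by rewrite -Kq /linked Huv.
  by case/orP => /GX[] //=; rewrite adjn_sym.
exists q.
  apply/and4P; split => //; last 2 first.
  - by rewrite Lq.
  - by apply/allP => v /(mem_pedges_last origin)[u /qG[]].
  by rewrite path_pedges; apply/allP => -[u v] /qG[].
move=> u v Huv; rewrite Kq /linked EG !mem_cat.
have NX x y : (x.1 <= a) || (y.1 <= a) -> (x, y) \in X = false.
  by case: x y => [x1 x2] [y1 y2] /= Hxy; apply/negP => /HX[_ /=]; lia.
by rewrite !NX // orbC.
Qed.

End RowByRow.

(** [El] collects the edges with an end in columns up to [a]; it reaches column [a + 1] only by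
    horizontal edges. Completing it preserves all those edges, so they can be read off the new
    walk. *)
Lemma cut_left a b h p : saw (a + b).+1 h p -> exists2 q, saw a.+2 h q &
  forall u v, (u.1 <= a) || (v.1 <= a) ->
    linked (pedges origin q) u v = linked (pedges origin p) u v.
Proof.
move=> /and4P[Pp Up /eqP Lp /allP Bp].
pose lft (e : point * point) := (e.1.1 <= a) || (e.2.1 <= a).
pose El := filter lft (pedges origin p).
have aE : acyclic El by apply/acyclic_filter/acyclic_pedges.
have d0 v := @deg_pedges _ origin p v Up.
have dE v : v.1 <= a -> deg El v = deg (pedges origin p) v.
  by move=> Hv; apply: eq_deg_filter => e _ /orP[]/eqP E; rewrite /lft E Hv ?orbT.
have d2 v : deg El v <= 2.
  apply: leq_trans (deg_filter_le _ _ _) _; rewrite d0; case: ifP => // _.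
  by case: (_ == _); case: (_ == _).
have Ep e : e \in pedges origin p -> [/\ adjn e.1 e.2, inbox (a + b).+1 h e.1
  & inbox (a + b).+1 h e.2].
  move=> He; split; first by move: Pp; rewrite path_pedges => /allP/(_ _ He).
    move: (pedges_mem He) => /andP[]; rewrite inE => /orP[/eqP ->//|/Bp //].
  by move: (pedges_mem He) => /andP[_ /Bp].
have HEl e : e \in El -> [/\ adjn e.1 e.2, lft e, inbox a.+1 h e.1 & inbox a.+1 h e.2].
  rewrite mem_filter => /andP[Le /Ep[A B C]]; split => //;
  by case: e A B C Le => [[x1 y1] [x2 y2]]; rewrite /adjn /inbox /lft /=; lia.
have [|||q sq Hq] := completion aE d2 HEl; last 1 first.
- exists q => // -[u1 u2] [v1 v2] /= Huv; rewrite Hq // /linked !mem_filter /lft /= Huv.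
  by rewrite [(v1 <= a) || _]orbC Huv.
(* Every edge of [El] at [(a + 1, y)] joins it to [(a, y)]. Two of them would form an even sub-list,
   against acyclicity. *)
- move=> y; rewrite leqNgt; apply/negP => Hy.
  have {Hy}Hy : deg El (a.+1, y) = 2 by move: (d2 (a.+1, y)); lia.
  pose b0 (e : point * point) := (e.1 == (a.+1, y)) || (e.2 == (a.+1, y)).
  have : filter b0 El = [::].
    apply: aE => v; have -> : deg (filter b0 El) v = ((v == (a.+1, y)) || (v == (a, y))) * 2;
      last by rewrite muln2 odd_double.
    have mE e : e \in filter b0 El -> mult e v = (v == (a.+1, y)) || (v == (a, y)).
      rewrite mem_filter => /andP[be /HEl[]].
      case: e be v => [[x1 y1] [x2 y2]] be [x z]; move: be;
        rewrite /b0 /mult /adjn /lft /= !xpair_eqE.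
      lia.
    have <- : size (filter b0 El) = 2.
      rewrite -Hy -(@eq_deg_filter _ b0) //.
      have : forall e, e \in filter b0 El -> mult e (a.+1, y) = 1.
        move=> e; rewrite mem_filter => /andP[be /HEl[]].
        case: e be => [[x1 y1] [x2 y2]]; rewrite /b0 /mult /adjn /lft /= !xpair_eqE.
        lia.
      elim: (filter b0 El) => //= e E IH He; rewrite deg_cons -IH ?He ?mem_head //.
      by move=> f Hf; apply: He; rewrite inE Hf orbT.
    elim: (filter b0 El) mE => [|e E IH] mE; first by rewrite muln0.
    rewrite deg_cons mE ?mem_head // IH /=; first by rewrite mulnS.
    by move=> f Hf; apply: mE; rewrite inE Hf orbT.
  move=> F0; move: Hy; rewrite -(@eq_deg_filter _ b0) // F0 //.
- by rewrite dE // d0 mem_head eqxx Lp.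
- move=> v Hv N0; rewrite dE // d0; case: ifP => // _; rewrite N0 Lp.
  by case: v Hv {N0} => x y /= Hx; rewrite xpair_eqE /even2; lia.
Qed.

(** * Counting walks in rectangles *)

Section PathMaps.
Variables (V W : eqType) (f : V -> W).
Implicit Types (s u v : V) (p : seq V).

Lemma pedges_rcons s p x : pedges s (rcons p x) = rcons (pedges s p) (last s p, x).
Proof. by rewrite -cats1 /pedges pairmap_cat -cats1. Qed.

Lemma last_rev_belast s p : last (last s p) (rev (belast s p)) = s.
Proof. by case: p => //= x p; rewrite rev_cons last_rcons. Qed.

Lemma rev_belast s p : last s p :: rev (belast s p) = rev (s :: p).
Proof. by rewrite (lastI s p) rev_rcons. Qed.

Lemma mem_pedges_rev s p u v :
  ((u, v) \in pedges (last s p) (rev (belast s p))) = ((v, u) \in pedges s p).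
Proof.
elim: p s => //= x p IH s; rewrite rev_cons pedges_rcons mem_rcons !inE IH last_rev_belast.
by rewrite !xpair_eqE [X in X || _]andbC.
Qed.

Lemma linked_rev s p u v :
  linked (pedges (last s p) (rev (belast s p))) u v = linked (pedges s p) u v.
Proof. by rewrite /linked !mem_pedges_rev orbC. Qed.

Lemma pedges_map s p : pedges (f s) (map f p) = [seq (f e.1, f e.2) | e <- pedges s p].
Proof. by elim: p s => //= x p IH s; rewrite IH. Qed.

Lemma linked_mem s p u v : linked (pedges s p) u v -> (u \in s :: p) && (v \in s :: p).
Proof.
by case/orP => /pedges_mem/andP[/= H1 H2]; rewrite !inE in H1 *; rewrite H1 H2 orbT.
Qed.

Lemma path_map_homo (r : rel V) (r' : rel W) s p :
  {homo f : u v / r u v >-> r' u v} -> path r s p -> path r' (f s) (map f p).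
Proof. by move=> H; rewrite path_map; apply: sub_path. Qed.

End PathMaps.

(** The start [f 0] is left out, as in the vertex lists of walks. *)
Definition seg (f : nat -> point) k := [seq f i | i <- iota 1 k].
Arguments seg : simpl never.

Lemma path_seg f k : (forall i, i < k -> adjn (f i) (f i.+1)) -> path adjn (f 0) (seg f k).
Proof.
have : forall n m, (forall i, n <= i < n + m -> adjn (f i) (f i.+1)) ->
    path adjn (f n) [seq f i | i <- iota n.+1 m].
  move=> n m; elim: m n => //= m IH n H; rewrite H ?IH //=; last by lia.
  by move=> i Hi; apply: H; lia.
by move=> H Hk; apply: H => i; rewrite add0n; apply: Hk.
Qed.

Lemma last_seg f k : last (f 0) (seg f k) = f k.
Proof. by case: k => // k; rewrite /seg -(addn1 k) iotaD map_cat last_cat /= add1n addn1. Qed.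

Lemma mem_seg f k v : v \in seg f k -> exists2 i, 0 < i <= k & v = f i.
Proof. by case/mapP => i; rewrite mem_iota => Hi ->; exists i => //; lia. Qed.

Lemma mem_cons_seg f k v : v \in f 0 :: seg f k -> exists2 i, i <= k & v = f i.
Proof.
rewrite inE => /orP[/eqP->|/mem_seg[i /andP[_ Hi] ->]]; first by exists 0.
by exists i.
Qed.

Lemma uniq_seg f k : (forall i j, i <= k -> j <= k -> f i = f j -> i = j) ->
  uniq (f 0 :: seg f k).
Proof.
move=> Hf; rewrite (_ : f 0 :: seg f k = [seq f i | i <- iota 0 k.+1]) //.
rewrite map_inj_in_uniq ?iota_uniq // => i j; rewrite !mem_iota => Hi Hj.
by apply: Hf; lia.
Qed.

Section Counting.
Variables a h : nat.
Notation T := (('I_a.+1 * 'I_h.+1)%type : finType).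

Definition to_point (v : T) : point := (v.1 : nat, v.2 : nat).

Definition saws : {set {bseq #|T| of T}} :=
  [set p : {bseq #|T| of T} | saw a h (map to_point p)].

Definition nsaw : nat := #|saws|.

(** Listing the walks as sequences of points gives boxes of different sizes a common type, in which
    they can be compared. *)
Definition walks : seq (seq point) := [seq map to_point (val p) | p <- enum saws].

Lemma to_point_inj : injective to_point.
Proof. by move=> [x y] [x' y'] [/val_inj-> /val_inj->]. Qed.

Lemma size_walks : size walks = nsaw.
Proof. by rewrite size_map -cardE. Qed.

Lemma uniq_walks : uniq walks.
Proof.
rewrite map_inj_uniq ?enum_uniq //; apply: inj_comp val_inj.
exact/inj_map/to_point_inj.
Qed.

(** [inord] returns a default value outside the range, whence the [inbox] hypotheses below. *)
Definition of_point (v : point) : T := (inord v.1, inord v.2).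

Lemma of_pointK v : inbox a h v -> to_point (of_point v) = v.
Proof. by case: v => x y /andP[/= Hx Hy]; rewrite /to_point /= !inordK. Qed.

Lemma of_pointsK p : all (inbox a h) p -> map to_point (map of_point p) = p.
Proof.
move=> /allP H; rewrite -map_comp -[RHS]map_id; apply/eq_in_map => v /H; exact: of_pointK.
Qed.

Lemma size_of_points p : uniq p -> all (inbox a h) p -> size (map of_point p) <= #|T|.
Proof.
move=> Up Bp; have U : uniq (map of_point p).
  by rewrite -(map_inj_uniq to_point_inj) of_pointsK.
by rewrite -(card_uniqP U) max_card.
Qed.

Lemma mem_walks p : (p \in walks) = saw a h p.
Proof.
apply/mapP/idP => [[q]|Hp]; first by rewrite mem_enum inE => ? ->.
have /and4P[_ Up _ Bp] := Hp.
have Hs : size (map of_point p) <= #|T|.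
  by apply: size_of_points => //; case/andP: Up.
by exists (Bseq Hs); rewrite ?mem_enum ?inE /= of_pointsK.
Qed.

Lemma nsaw_leq (U : eqType) (f : seq point -> U) (s : seq U) :
  (forall p, saw a h p -> f p \in s) ->
  (forall p q, saw a h p -> saw a h q -> f p = f q -> p = q) -> nsaw <= size s.
Proof.
move=> Hs Hinj; rewrite -size_walks -(size_map f); apply: uniq_leq_size.
  by rewrite map_inj_in_uniq ?uniq_walks // => p q; rewrite !mem_walks; apply: Hinj.
by move=> u /mapP[p]; rewrite mem_walks => /Hs + ->.
Qed.

End Counting.

Lemma leq_nsaw a h (s : seq (seq point)) : uniq s -> all (saw a h) s -> size s <= nsaw a h.
Proof.
move=> Us /allP Hs; rewrite -size_walks; apply: uniq_leq_size => // p /Hs.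
by rewrite mem_walks.
Qed.

Lemma saw_inj a h p q : saw a h p -> saw a h q ->
  linked (pedges origin p) =2 linked (pedges origin q) -> p = q.
Proof. by move=> /and4P[_ Up _ _] /and4P[_ Uq _ _]; apply: pedges_inj. Qed.

Lemma saw_inbox a h p v : saw a h p -> v \in origin :: p -> inbox a h v.
Proof. by move=> /and4P[_ _ _ /allP Bp]; rewrite inE => /orP[/eqP ->//|/Bp]. Qed.

(** * Half-turn of the box, cutting and gluing inequalities *)

Definition rot_point a h (v : point) : point := (a - v.1, h - v.2).

Lemma rot_pointK a h v : inbox a h v -> rot_point a h (rot_point a h v) = v.
Proof. by case: v => x y /andP[/= Hx Hy]; rewrite /rot_point /= !subKn. Qed.

Lemma rot_inbox a h v : inbox a h (rot_point a h v).
Proof. by rewrite /inbox !leq_subr. Qed.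

(** The half-turn exchanges the two corners, so the rotated walk is also reversed in order to start
    at the origin. *)
Lemma saw_rot a h p : saw a h p -> exists2 q, saw a h q
  & forall u v, inbox a h u -> inbox a h v ->
  linked (pedges origin q) u v = linked (pedges origin p) (rot_point a h u) (rot_point a h v).
Proof.
move=> Hp; have /and4P[Pp Up /eqP Lp Bp] := Hp.
pose r := rot_point a h;
  have E0 : r (last origin p) = origin by rewrite Lp /r /rot_point /= !subnn.
have rI : {in inbox a h &, injective r}.
  by move=> u v Hu Hv H; rewrite -(rot_pointK Hu) -(rot_pointK Hv) -/r H.
exists (map r (rev (belast origin p))).
- apply/and4P; split.
  + rewrite -[X in path adjn X _]E0 path_map rev_path path_pedges; apply/allP => -[u v] Huv /=.
    have [/(saw_inbox Hp)/andP[u1 u2] /= Hv] := andP (pedges_mem Huv).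
    have /andP[v1 v2] : inbox a h v by apply: (saw_inbox Hp); rewrite inE Hv orbT.
    move: Pp; rewrite path_pedges => /allP/(_ _ Huv);
      case: u v {Huv Hv} u1 u2 v1 v2 => [x y] [x' y'].
    by rewrite /r /rot_point /adjn /=; lia.
  + rewrite (_ : origin :: _ = map r (rev (origin :: p))); last by rewrite -rev_belast /= E0.
    rewrite map_inj_in_uniq ?rev_uniq //.
    by move=> u v; rewrite !mem_rev => /(saw_inbox Hp) Hu /(saw_inbox Hp) Hv; apply: rI.
  + by rewrite -[X in last X _]E0 last_map last_rev_belast /r /rot_point /= !subn0.
  + by apply/allP => _ /mapP[v _ ->]; apply: rot_inbox.
move=> u v Hu Hv; rewrite -[X in pedges X _]E0 -(linked_rev origin p) /linked !pedges_map.
have M x y : inbox a h x -> inbox a h y ->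
  ((x, y) \in [seq (r e.1, r e.2) | e <- pedges (last origin p) (rev (belast origin p))]) =
  ((r x, r y) \in pedges (last origin p) (rev (belast origin p))).
  move=> Hx Hy; apply/mapP/idP => [[[z t] Hzt [-> ->]]|H]; last first.
    by exists (r x, r y) => //=; rewrite /r !rot_pointK.
  move: (Hzt); rewrite mem_pedges_rev => /pedges_mem/andP[/= H1 H2].
  by rewrite /r !rot_pointK // (saw_inbox Hp) // inE H2 orbT.
by rewrite !M.
Qed.

(** The half-turn sends the columns beyond [a] to the columns up to [b], where [cut_left]
    applies. *)
Lemma cut_right a b h p : saw (a + b).+1 h p -> exists2 q, saw b.+2 h q &
  forall u v, inbox (a + b).+1 h u -> inbox (a + b).+1 h v -> (a < u.1) || (a < v.1) ->
    linked (pedges origin p) u v =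
    linked (pedges origin q) (rot_point (a + b).+1 h u) (rot_point (a + b).+1 h v).
Proof.
move=> /saw_rot[p' Hp' Hl]; rewrite addnC in Hp'.
have [q Hq Hql] := cut_left Hp'; exists q => // u v Hu Hv Huv.
rewrite Hql ?Hl ?rot_inbox ?rot_pointK //.
by move: Huv; rewrite /rot_point /=; lia.
Qed.

(** The pair of completed halves determines the walk: an edge with an end in columns up to [a] is
    read from the left half, any other from the right half. The completions are not canonical, so a
    pair is fixed by choice for each walk. *)
Lemma nsaw_cut a b h : nsaw (a + b).+1 h <= nsaw a.+2 h * nsaw b.+2 h.
Proof.
have /choice[f Hf] : forall p, exists q : seq point * seq point, saw (a + b).+1 h p ->
  [/\ saw a.+2 h q.1, saw b.+2 h q.2,
    forall u v, (u.1 <= a) || (v.1 <= a) ->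
      linked (pedges origin q.1) u v = linked (pedges origin p) u v
  & forall u v, inbox (a + b).+1 h u -> inbox (a + b).+1 h v -> (a < u.1) || (a < v.1) ->
      linked (pedges origin p) u v =
      linked (pedges origin q.2) (rot_point (a + b).+1 h u) (rot_point (a + b).+1 h v)].
  move=> p; have [Hp|] := boolP (saw (a + b).+1 h p); last by exists ([::], [::]).
  by have [q1 ? ?] := cut_left Hp; have [q2 ? ?] := cut_right Hp; exists (q1, q2).
rewrite -!size_walks -(size_allpairs pair) size_walks;
  apply: (nsaw_leq (f := f)) => [p|p q Hp Hq Epq].
  by move=> /Hf[H1 H2 _ _]; rewrite [f p]surjective_pairing; apply: allpairs_f; rewrite mem_walks.
have [_ _ Lp Rp] := Hf _ Hp; have [_ _ Lq Rq] := Hf _ Hq.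
apply: (saw_inj Hp Hq) => u v.
have [Huv|Huv] := boolP ((u.1 <= a) || (v.1 <= a)); first by rewrite -Lp // -Lq // Epq.
have Huv' : (a < u.1) || (a < v.1) by rewrite !ltnNge -negb_and; apply: contra Huv => /andP[-> _].
have [/andP[Hu Hv]|Nuv] := boolP (inbox (a + b).+1 h u && inbox (a + b).+1 h v).
  by rewrite Rp // Rq // Epq.
have off r : saw (a + b).+1 h r -> linked (pedges origin r) u v = false.
  move=> Hr; apply/negbTE; apply: contra Nuv => /linked_mem/andP[Hu Hv].
  by rewrite !(saw_inbox Hr).
by rewrite !off.
Qed.

Lemma nsaw_glue a b h : nsaw a h * nsaw b h <= nsaw (a + b).+2 h.
Proof.
pose shift (v : point) : point := (v.1 + a.+2, v.2).
(* The first walk ends at the top of column [a]; column [a + 1] leads down to the bottom, where the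
   second walk starts in column [a + 2]. *)
pose fc i : point := (a.+1, h - i); pose col := fc 0 :: seg fc h.
pose F p q := p ++ col ++ map shift (origin :: q).
have shiftI : injective shift by move=> [x y] [x' y'] [/addIn -> ->].
have colE v : v \in col -> v.1 = a.+1.
  by case/mem_cons_seg => i _ ->.
(* Both walks are recovered from the glued one by selecting columns, which gives injectivity. *)
have FE p q : saw a h p -> [seq v : point <- F p q | v.1 <= a] = p /\
    [seq v : point <- F p q | a.+1 < v.1] = map shift (origin :: q).
  move=> Hp; have px v : v \in p -> v.1 <= a.
    by move=> Hv; have /andP[] : inbox a h v by apply: (saw_inbox Hp); rewrite inE Hv orbT.
  have none (P : pred point) r : (forall v, v \in r -> ~~ P v) -> [seq v <- r | P v] = [::].
    by move=> H; rewrite (eq_in_filter (a2 := pred0)) ?filter_pred0 // => v /H/negPf.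
  have every (P : pred point) r : (forall v, v \in r -> P v) -> [seq v <- r | P v] = r.
    by move=> H; apply/all_filterP/allP.
  rewrite /F !filter_cat; split.
    rewrite (every _ p) // (none _ col) ?(none _ (map _ _)) ?cats0 // => v.
      by move=> /mapP[w _ ->] /=; lia.
    by move=> /colE ->; lia.
  rewrite (none _ p) ?(none _ col) ?(every _ (map _ _)) // => v.
  + by move=> /mapP[w _ ->] /=; lia.
  + by move=> /colE ->; lia.
  + by move=> /px Hv; rewrite -leqNgt leqW.
rewrite -!size_walks -(size_allpairs F) size_walks; apply: leq_nsaw.
  apply: allpairs_uniq; rewrite ?uniq_walks // => -[p q] [p' q'].
  move=> /allpairsP[[p1 q1] /= [+ _ [-> ->]]] /allpairsP[[p2 q2] /= [+ _ [-> ->]]].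
  rewrite !mem_walks => /FE H1 /FE H2 EF.
  have [A1 A2] := H1 q1; have [B1 B2] := H2 q2; rewrite EF in A1 A2.
  congr pair; first by rewrite -A1 B1.
  have : map shift (origin :: q1) = map shift (origin :: q2) by rewrite -A2 B2.
  by move/(inj_map shiftI) => [].
apply/allP => _ /allpairsP[[p q] /= [+ + ->]]; rewrite !mem_walks => Hp Hq.
have /and4P[Pp Up /eqP Lp /allP Bp] := Hp; have /and4P[Pq Uq /eqP Lq /allP Bq] := Hq.
have colB v : v \in col -> inbox (a + b).+2 h v.
  by move=> /mem_cons_seg[i _ ->]; rewrite /fc /inbox /=; lia.
have Ucol : uniq col.
  by apply: uniq_seg => i j Hi Hj []; lia.
apply/and4P; split.
- rewrite cat_path Pp Lp /= cat_path last_seg /= path_map; apply/and4P; split.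
  + by rewrite /adjn /=; lia.
  + by apply: path_seg => i Hi; rewrite /adjn /=; lia.
  + by rewrite /adjn /=; lia.
  + by apply: sub_path Pq => u v; rewrite /adjn /shift /=; lia.
- rewrite -cat_cons cat_uniq Up cat_uniq Ucol map_inj_uniq // Uq andbT !andTb.
  have N x : x \in origin :: p -> x.1 <= a by move=> /(saw_inbox Hp)/andP[].
  apply/andP; split; last by apply/hasPn => v /mapP[w _ ->]; apply/negP => /colE /=; lia.
  apply/hasPn => v; rewrite mem_cat => /orP[/colE Hv|/mapP[w _ Ev]]; apply/negP => /N.
    by rewrite Hv ltnn.
  by rewrite Ev /=; lia.
- by rewrite !last_cat /= last_map Lq /shift /=; apply/eqP; congr pair; lia.
- rewrite !all_cat; apply/and3P; split; apply/allP => v.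
  + by move=> /Bp; rewrite /inbox; lia.
  + exact: colB.
  + by move=> /mapP[w /(saw_inbox Hq)] + ->; rewrite /inbox /=; lia.
Qed.

Lemma nsaw_sym a h : nsaw a h <= nsaw h a.
Proof.
pose tr (v : point) : point := (v.2, v.1).
have trI : injective tr by move=> [x y] [x' y'] [-> ->].
rewrite -[nsaw h a]size_walks; apply: (nsaw_leq (f := map tr)) => [p|p q _ _];
  last exact: inj_map.
move=> /and4P[Pp Up /eqP Lp /allP Bp]; rewrite mem_walks; apply/and4P; split.
- rewrite -[X in path _ X _]/(tr origin); apply: path_map_homo Pp => u v.
  by rewrite /adjn /=; lia.
- by rewrite -[X in X :: _]/(tr origin) -map_cons map_inj_uniq.
- by rewrite -[X in last X _]/(tr origin) last_map Lp.
- by apply/allP => _ /mapP[v /Bp + ->]; rewrite /inbox /= andbC.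
Qed.

Lemma nsawC a h : nsaw a h = nsaw h a.
Proof. by apply/eqP; rewrite eqn_leq !nsaw_sym. Qed.

Lemma nsaw_mono a h : nsaw a h <= nsaw a.+1 h.
Proof.
rewrite -[nsaw a.+1 h]size_walks;
  apply: (nsaw_leq (f := fun p => rcons p (a.+1, h))) => [p|p q _ _]; last first.
  by move/rcons_inj => [].
move=> Hp; have /and4P[Pp Up /eqP Lp /allP Bp] := Hp.
rewrite mem_walks; apply/and4P; split.
- by rewrite rcons_path Pp Lp /adjn /=; lia.
- rewrite -rcons_cons rcons_uniq Up andbT; apply/negP => /(saw_inbox Hp).
  by rewrite /inbox /=; lia.
- by rewrite last_rcons.
- rewrite all_rcons; apply/andP; split; first by rewrite /inbox /= !leqnn.
  by apply/allP => v /Bp; rewrite /inbox; lia.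
Qed.

Lemma nsaw_gt0 a h : 0 < nsaw a h.
Proof.
have H n : 0 < nsaw n 0.
  elim: n => [|n IH]; last exact: leq_trans IH (nsaw_mono _ _).
  by apply: (@leq_trans (size [:: [::] : seq point])) => //; apply: leq_nsaw.
by elim: a => [|a IH]; [rewrite nsawC|apply: leq_trans IH (nsaw_mono _ _)].
Qed.

(** This strict inequality is what makes the growth exponent positive in the end. *)
Lemma nsaw11 : 1 < nsaw 1 1.
Proof.
apply: (@leq_trans (size ([:: [:: (0, 1); (1, 1)]; [:: (1, 0);
  (1, 1)]] : seq (seq point)))) => //.
exact: leq_nsaw.
Qed.

(** * Walks and polygons *)

Lemma path_consE (T : Type) (e : rel T) x y s : path e x (y :: s) = e x y && path e y s.
Proof. by []. Qed.

Lemma pedges_fst (T : eqType) (s x : T) p : [seq e.1 | e <- pedges s (rcons p x)] = s :: p.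
Proof. by elim: p s => //= y p IH s; rewrite IH. Qed.

Lemma pedges_rcons_mem (T : eqType) (s x : T) p e : p != [::] ->
  e \in pedges s (rcons p x) -> (e.1 \in p) || (e.2 \in p).
Proof.
case: p => // y p _; rewrite (in_cons (s, y)) => /orP[/eqP->|He];
  first by rewrite /= mem_head orbT.
by have := map_f fst He; rewrite [map _ _](pedges_fst y x p) => ->.
Qed.

Section Cycles.
Variable T : finType.
Implicit Types (x y u v : T) (r : seq T).

(** Translates [next], on which [cycle_edges] is built, into consecutive pairs of the closed
    sequence, so that the facts about [pedges] apply to polygons. *)
Lemma mem_pedges_next x y0 y r z : uniq (y :: r) -> x \in y :: r ->
  ((x, z) \in pedges y (rcons r y0)) = (z == next_at x y0 y r).
Proof.
elim: r y => [|w r IH] y.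
  by rewrite /= !inE xpair_eqE => _ /eqP ->; rewrite eqxx.
rewrite [uniq _]/= => /andP[Hy Hw]; rewrite in_cons /= (in_cons (y, w)) xpair_eqE.
have [-> _ /=|xy /= Hx] := eqVneq x y; last by rewrite -IH.
suff -> : (y, z) \in pedges w (rcons r y0) = false by rewrite orbF.
apply: contraNF Hy => H; by have := map_f fst H; rewrite [map _ _](pedges_fst w y0 r).
Qed.

Lemma cycle_edgesP x r (S : {set T}) : uniq (x :: r) ->
  reflect (exists2 e, e \in pedges x (rcons r x) & S = [set e.1;
    e.2]) (S \in cycle_edges (x :: r)).
Proof.
move=> U; apply: (iffP imsetP) => [[y Hy ->]|[[y z] He ->]].
  by exists (y, next (x :: r) y) => //; rewrite mem_pedges_next.
have Hy : y \in x :: r.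
  have /andP[/= + _] := pedges_mem He; rewrite inE mem_rcons inE => /orP[/eqP->|//].
  exact: mem_head.
by exists y => //; move: He; rewrite mem_pedges_next // => /eqP ->.
Qed.

Lemma set2_inj x y u v : [set x; y] = [set u; v] -> (x, y) = (u, v) \/ (x, y) = (v, u).
Proof.
move=> E; have Hx : x \in [set u; v] by rewrite -E set21.
have Hy : y \in [set u; v] by rewrite -E set22.
have Hu : u \in [set x; y] by rewrite E set21.
have Hv : v \in [set x; y] by rewrite E set22.
move: Hx Hy Hu Hv; rewrite !inE.
move=> /orP[]/eqP -> /orP[]/eqP ->; rewrite ?orbb; do ?[by left|by right].
  by move=> _ /eqP ->; left.
by move=> /eqP ->; left.
Qed.

Lemma linked_cycle_edges x r u v : uniq (x :: r) ->
  ([set u; v] \in cycle_edges (x :: r)) = linked (pedges x (rcons r x)) u v.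
Proof.
move=> U; apply/(cycle_edgesP _ U)/orP => [[[y z] He /set2_inj[[-> ->]|[-> ->]]]|[] H];
  [by left|by right|..].
  by exists (u, v).
by exists (v, u) => //=; rewrite setUC.
Qed.

Lemma cycle_edges_rot n (s : seq T) : uniq s -> cycle_edges (rot n s) = cycle_edges s.
Proof.
move=> U; apply/setP => S; apply/imsetP/imsetP => -[y Hy ->]; exists y; rewrite ?next_rot //.
  by rewrite mem_rot in Hy.
by rewrite mem_rot.
Qed.

Lemma cycle_edges_rev x r : uniq (x :: r) -> cycle_edges (x :: rev r) = cycle_edges (x :: r).
Proof.
move=> U; have U' : uniq (x :: rev r) by rewrite /= mem_rev rev_uniq.
have P : pedges x (rcons (rev r) x) =i [seq (e.2, e.1) | e <- pedges x (rcons r x)].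
  move=> [u v]; rewrite -rev_cons -(belast_rcons x r x) -{1}(last_rcons x r x) mem_pedges_rev.
  by apply/idP/mapP => [H|[[z t] H [-> ->]] //]; exists (v, u).
apply/setP => S; apply/(cycle_edgesP _ U')/(cycle_edgesP _ U) => -[e].
  rewrite P => /mapP[f Hf ->] ->; exists f => //=; exact: setUC.
by move=> He ->; exists (e.2, e.1); rewrite /= 1?setUC // P; apply: map_f He.
Qed.

End Cycles.

Lemma square_adjE L (u v : vertex L) : square_adj u v = adjn (to_point u) (to_point v).
Proof. by rewrite /square_adj /relpre /= /lattice_adj /adjn /=; lia. Qed.

Lemma inbox_to_point a h (v : 'I_a.+1 * 'I_h.+1) : inbox a h (to_point v).
Proof. by apply/andP; split; rewrite -ltnS ltn_ord. Qed.

Lemma C_nsaw L : C L = nsaw L L.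
Proof.
apply: eq_card => p; rewrite !inE /saw.
have O : to_point (corner00 L) = origin by [].
rewrite -O path_map (eq_path (@square_adjE L)) -map_cons (map_inj_uniq (@to_point_inj _ _))
  last_map.
rewrite (_ : all _ _ = true) ?andbT; last by apply/allP => _ /mapP[v _ ->]; apply: inbox_to_point.
by congr [&& _, _ & _].
Qed.

Lemma of_point_adj L (u v : point) : inbox L L u -> inbox L L v ->
  square_adj (of_point L L u) (of_point L L v) = adjn u v.
Proof. by move=> Hu Hv; rewrite square_adjE !of_pointK. Qed.

Lemma of_point_inj a h : {in inbox a h &, injective (of_point a h)}.
Proof. by move=> u v Hu Hv H; rewrite -(of_pointK Hu) -(of_pointK Hv) H. Qed.

Lemma mem_polygons L x r : 1 < size r -> uniq (x :: r) -> path (@square_adj L) x (rcons r x) ->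
  cycle_edges (x :: r) \in polygons L.
Proof.
move=> Hr U Hp; rewrite inE; apply/existsP.
have Hs : size (x :: r) <= #|vertex L| by rewrite -(card_uniqP U) max_card.
by exists (Bseq Hs); apply/and3P; split => //; apply/andP; split.
Qed.

(** The walk is raised by one row, then closed down column [L + 1] and back along row 0 to its
    start. *)
Lemma nsaw_le_P L : nsaw L L <= P L.+1.
Proof.
pose up (v : point) : point := (v.1, v.2.+1).
pose fc i : point := (L.+1, L.+1 - i); pose fr i : point := (L - i, 0).
pose clo := (fc 0 :: seg fc L.+1) ++ fr 0 :: seg fr L.
pose o p := of_point L.+1 L.+1 p.
pose loop p := map up p ++ clo.
have upI : injective up by move=> [x y] [x' y'] [-> ->].
have cloP v : v \in clo -> [/\ inbox L.+1 L.+1 v & (v.1 == L.+1) || (v.2 == 0)].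
  rewrite mem_cat => /orP[]/mem_cons_seg[i Hi ->]; rewrite /inbox /=; split; lia.
have Uclo : uniq clo.
  rewrite cat_uniq !uniq_seg //; last 2 first.
  - by move=> i j Hi Hj []; lia.
  - by move=> i j Hi Hj []; lia.
  rewrite andbT; apply/hasPn => v /mem_cons_seg[i Hi ->]; apply/negP => /mem_cons_seg[j Hj []];
    lia.
have sawB p : saw L L p -> all (inbox L.+1 L.+1) (up origin :: loop p).
  move=> Hp; apply/allP => v; rewrite -cat_cons -map_cons mem_cat => /orP[|/cloP[]//].
  by move=> /mapP[w /(saw_inbox Hp)] + ->; rewrite /inbox /=; lia.
have sawU p : saw L L p -> uniq (up origin :: loop p).
  move=> Hp; have /and4P[_ Up _ _] := Hp.
  rewrite -cat_cons -map_cons cat_uniq map_inj_uniq // Up Uclo andbT.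
  apply/hasPn => v /cloP[_ Hv]; apply/negP => /mapP[w /(saw_inbox Hp)] + Ev.
  by move: Hv; rewrite Ev /inbox /=; lia.
have oU p : saw L L p -> uniq (o (up origin) :: map o (loop p)).
  move=> Hp; rewrite -map_cons map_inj_in_uniq ?sawU // => u v Hu Hv.
  by apply: of_point_inj; apply: (allP (sawB _ Hp)).
have sawP p : saw L L p -> path adjn (up origin) (rcons (loop p) (up origin)).
  move=> Hp; have /and4P[Pp _ /eqP Lp _] := Hp.
  rewrite rcons_path cat_path last_cat last_map Lp; apply/andP; split; last first.
    by rewrite last_cat /= last_seg /fr subnn.
  rewrite (path_map_homo _ Pp) ?andTb; last by move=> u v; rewrite /adjn /=; lia.
  rewrite /clo cat_path (path_consE _ _ (fc 0)) (path_consE _ _ (fr 0)) last_cons last_seg;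
    apply/andP; split; apply/andP; split.
  - by rewrite /adjn /=; lia.
  - by apply: path_seg => i Hi; rewrite /adjn /=; lia.
  - by rewrite /adjn /=; lia.
  - by apply: path_seg => i Hi; rewrite /adjn /=; lia.
rewrite /P cardE.
apply: (nsaw_leq (f := fun p => cycle_edges (o (up origin) :: map o (loop p)))) =>
  [p Hp|p q Hp Hq Epq].
  rewrite mem_enum; apply: mem_polygons; [|exact: oU|].
    by rewrite size_map size_cat size_cat /=; lia.
  have := sawP p Hp; rewrite -map_rcons !path_pedges pedges_map => /allP H.
  apply/allP => _ /mapP[e He ->] /=; have /andP[e1 e2] := pedges_mem He.
  have B v : v \in up origin :: rcons (loop p) (up origin) -> inbox L.+1 L.+1 v.
    by rewrite inE mem_rcons => /orP[/eqP ->|/(allP (sawB _ Hp))] //; rewrite /inbox.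
  by rewrite of_point_adj ?H // B // inE e2 orbT.
(* Every closing edge has an end in [clo], which contains no raised point. Hence the polygon edges
   between raised points are exactly the edges of the walk. *)
have key r u v : saw L L r -> inbox L L u -> inbox L L v ->
    ([set o (up u); o (up v)] \in cycle_edges (o (up origin) :: map o (loop r))) =
    linked (pedges origin r) u v.
  move=> Hr Hu Hv; rewrite linked_cycle_edges ?oU // -map_rcons.
  have upB w : inbox L L w -> inbox L.+1 L.+1 (up w) by rewrite /inbox /=; lia.
  have upclo w : inbox L L w -> up w \notin clo by move=> Hw; apply/negP => /cloP[_]; move: Hw;
    rewrite /inbox /=; lia.
  have K u' v' : inbox L L u' -> inbox L L v' ->
      ((o (up u'), o (up v')) \in pedges (o (up origin)) [seq o i | i <- rcons (loop r) (up
        origin)]) =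
      ((u', v') \in pedges origin r).
    move=> Hu' Hv'; rewrite pedges_map /pedges rcons_cat pairmap_cat -!/(pedges _ _) pedges_map.
    apply/mapP/idP => [[[y z]]|H]; last first.
      by exists (up u', up v') => //; rewrite mem_cat; apply/orP; left;
        apply: (map_f (fun e => (up e.1, up e.2)) H).
    rewrite mem_cat => /orP[/mapP[[y' z'] Hyz [-> ->]]|Hyz] Eyz;
      have Ey := congr1 fst Eyz; have Ez := congr1 snd Eyz; rewrite /= in Ey Ez.
      have [/= M1 M2] := andP (pedges_mem Hyz).
      have By := saw_inbox Hr M1.
      have Bz : inbox L L z' by apply: (saw_inbox Hr); rewrite inE M2 orbT.
      have -> : u' = y' by apply/upI/of_point_inj/Ey; apply: upB.
      by have -> : v' = z' by apply/upI/of_point_inj/Ez; apply: upB.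
    have clo_out t w : inbox L L w -> o (up w) = o t -> t \notin clo.
      move=> Hw Et; apply/negP => Ht; have /negP := upclo _ Hw; apply.
      by have [Bt _] := cloP _ Ht; rewrite (of_point_inj (upB _ Hw) Bt Et).
    case/orP: (pedges_rcons_mem (isT : clo != [::]) Hyz) => /= [|].
      by rewrite (negPf (clo_out _ _ Hu' Ey)).
    by rewrite (negPf (clo_out _ _ Hv' Ez)).
  by rewrite /linked !K.
apply: (saw_inj Hp Hq) => u v.
have [/andP[Hu Hv]|Nuv] := boolP (inbox L L u && inbox L L v); first by rewrite -!key // Epq.
have off r : saw L L r -> linked (pedges origin r) u v = false.
  move=> Hr; apply/negbTE; apply: contra Nuv => /linked_mem/andP[Hu Hv].
  by rewrite !(saw_inbox Hr).
by rewrite !off.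
Qed.

(* [u] is the leftmost lowest vertex of the polygon, traversed so that its
   edge to the right comes last. *)
Lemma polygon_lowest L E : E \in polygons L ->
  exists ur : vertex L * seq (vertex L), let: (u, r) := ur in
  [/\ E = cycle_edges (u :: r), uniq (u :: r), path (@square_adj L) u r,
      to_point (last u r) = ((u.1).+1, u.2 : nat)
    & forall v, v \in r -> u.2 < v.2 \/ (u.2 = v.2 :> nat /\ u.1 < v.1)].
Proof.
rewrite inE => /existsP[s /and3P[Hs /andP[Cs Us] /eqP ->]].
(* Minimising [key] means taking the lowest row first and then the leftmost column. *)
pose key (v : vertex L) := v.2 * L.+1 + v.1.
have keyI : injective key.
  move=> [x y] [x' y']; rewrite /key /= => H.
  have := congr1 (modn^~ L.+1) H; have := congr1 (divn^~ L.+1) H.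
  rewrite !modnMDl !modn_small ?ltn_ord // !divnMDl // !divn_small ?ltn_ord // !addn0.
  by move=> /val_inj-> /val_inj->.
have [v0 Hv0] : exists v0, v0 \in val s by case: s Hs {Cs Us} => -[|v l] //= _ _; exists v;
  apply: mem_head.
pose u := [arg min_(v < v0 | v \in val s) key v].
have [Hu umin] : u \in val s /\ forall v, v \in val s -> key u <= key v.
  by rewrite /u; case: arg_minnP => // i Hi Hmin; split.
have [i r Er] := rot_to Hu.
have Ur : uniq (u :: r) by rewrite -Er rot_uniq.
have Cr : path (@square_adj L) u (rcons r u) by have : cycle (@square_adj L) (u :: r)
  by rewrite -Er rot_cycle.
have Sr : 1 < size r by rewrite -ltnS -[(size r).+1]/(size (u :: r)) -Er size_rot.
have Hmin v : v \in r -> u.2 < v.2 \/ (u.2 = v.2 :> nat /\ u.1 < v.1).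
  move=> Hv; have vu : v != u by apply: contraTneq Ur => <-; rewrite /= Hv.
  have : key u <= key v by apply: umin; rewrite -(mem_rot i) Er inE Hv orbT.
  rewrite leq_eqVlt => /orP[/eqP/keyI uv|]; first by rewrite uv eqxx in vu.
  rewrite /key => K; have := ltn_ord u.1; have := ltn_ord v.1 => ? ?.
  have [?|?|H] := ltngtP u.2 v.2; first by left.
    by nia.
  by right; split => //; rewrite H in K; lia.
(* By minimality the neighbours of [u] on the polygon can only be to its right or above it. *)
have cand v : v \in r -> square_adj u v -> to_point v = ((u.1).+1, u.2 : nat) \/
    to_point v = (u.1 : nat, (u.2).+1).
  move=> /Hmin; rewrite square_adjE /adjn /to_point /=.
  case: v u {Hu umin Er Ur Cr Hmin} => [x y] [x' y'] /= H1 H2.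
  have [[->->]|[->->]] : ((x = x'.+1 :> nat /\ y = y' :> nat) \/ (x = x' :> nat /\ y =
    y'.+1 :> nat)) by lia.
    by left.
  by right.
rewrite -(cycle_edges_rot i Us) Er.
case: r Ur Cr Sr Hmin cand {Er} => // a r Ur Cr Sr Hmin cand.
have [Pr ur] : path (@square_adj L) u (a :: r) /\ square_adj (last a r) u.
  by move: Cr; rewrite rcons_path => /andP[].
have sym : symmetric (@square_adj L) by move=> v w; rewrite !square_adjE adjn_sym.
have [Ea|Ea] := cand (last a r) (mem_last _ _) (etrans (sym _ _) ur).
  by exists (u, a :: r).
(* The cycle has at least three vertices, so its first and last neighbours of [u] differ. If the
   last is above, the first is to the right, and the cycle is reversed. *)
have [Eb|Eb] := cand a (mem_head _ _) (andP Pr).1; last first.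
  have ab : a = last a r by apply: to_point_inj; rewrite Ea Eb.
  case: r Sr Ur ab {Cr Hmin cand ur Ea Pr} => // b r _ /and3P[_ + _] /= ab.
  by rewrite {1}ab mem_last.
exists (u, rev (a :: r)); split.
- by rewrite cycle_edges_rev.
- by rewrite /= mem_rev rev_uniq.
- have : path (@square_adj L) u (rcons (rev (a :: r)) u).
    rewrite -rev_cons -(belast_rcons u (a :: r) u) -{1}(last_rcons u (a :: r) u) rev_path.
    by rewrite (eq_path (e' := @square_adj L)).
  by rewrite rcons_path => /andP[].
- by rewrite rev_cons last_rcons.
- by move=> v; rewrite mem_rev; apply: Hmin.
Qed.

(* The polygon is translated by (1, 1).  The walk reaches its leftmost lowest
   vertex [(x, y)] along column 0 and row [y + 1]; it leaves the last vertex
   [(x + 1, y)] downwards, along row [y] and then column [L + 2]. *)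
Definition opening_in x y := seg (fun j => (0, j)) y.+1 ++ seg (fun i => (i, y.+1)) x.

Definition opening_out L x y :=
  ((x + 2, y) :: seg (fun i => (x + 2 + i, y)) (L - x)) ++ seg (fun i =>
    (L.+2, y + i)) (L.+1 - y).

Definition shift11 (v : point) : point := (v.1.+1, v.2.+1).

Definition opening L x y (r : seq point) :=
  opening_in x y ++ map shift11 ((x, y) :: r) ++ opening_out L x y.

Lemma shift11_inj : injective shift11.
Proof. by move=> [x y] [x' y'] [-> ->]. Qed.

Lemma opening_inj L x y : injective (opening L x y).
Proof.
move=> r r' /eqP; rewrite eqseq_cat // eqxx andTb => /eqP H.
apply: (inj_map shift11_inj); apply/eqP; move/eqP: H.
have [H|H] := eqVneq (size r) (size r');
  first by rewrite eqseq_cons eqseq_cat ?size_map // => /and3P[].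
move=> /eqP/(congr1 size); rewrite !size_cat !size_map /= => E.
by move: H; rewrite (_ : size r = size r') ?eqxx //; lia.
Qed.

(** The walk omits the edge from the lowest vertex to its right neighbour and passes through all the
    others between its entrance and its exit. *)
Lemma saw_opening L x y r : path adjn (x, y) r -> uniq ((x, y) :: r) ->
  all (inbox L L) ((x, y) :: r) -> last (x, y) r = (x.+1, y) ->
  (forall v, v \in r -> (y < v.2) || (y == v.2) && (x < v.1)) ->
  saw L.+2 L.+1 (opening L x y r).
Proof.
move=> Pr Ur /allP Br Lr Hr.
pose f1 j : point := (0, j); pose f2 i : point := (i, y.+1).
pose f3 i : point := (x + 2 + i, y); pose f4 i : point := (L.+2, y + i).
have E3 : (x + 2, y) = f3 0 by rewrite /f3 addn0.
have xL : x < L.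
  have /Br : (x.+1, y) \in (x, y) :: r by rewrite -Lr mem_last.
  by rewrite /inbox /=; lia.
have yL : y <= L by have := Br _ (mem_head _ _); rewrite /inbox /=; lia.
have E4 : f3 (L - x) = f4 0 by rewrite /f3 /f4; congr pair; lia.
(* Disjointness: the translated polygon avoids column 0, lies above row [y], begins in row [y + 1]
   only after column [x], and ends before column [L + 2]. *)
have inP v : v \in opening_in x y ->
    [/\ v.1 <= x, v.2 <= y.+1, (v.1 == 0) || (v.2 == y.+1) & v != origin].
  by rewrite mem_cat => /orP[]/mem_seg[i Hi ->]; rewrite /= xpair_eqE; split; lia.
have outP v : v \in opening_out L x y ->
    [/\ x.+1 < v.1 <= L.+2, y <= v.2 <= L.+1 & (v.1 == L.+2) || (v.2 == y)].
  by rewrite mem_cat E3 => /orP[/(@mem_cons_seg f3)|/mem_seg] [i Hi ->]; rewrite /=; split; lia.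
have shP v : v \in map shift11 ((x, y) :: r) ->
    [/\ 0 < v.1 <= L.+1, y < v.2 <= L.+1 & (y.+1 < v.2) || (x < v.1)].
  move=> /mapP[w Hw ->]; have := Br _ Hw; move: Hw; rewrite /inbox /= inE.
  by move=> /orP[/eqP->|/Hr]; rewrite /=; split; lia.
apply/and4P; split.
- rewrite /opening cat_path [path _ _ (map _ _ ++ _)]cat_path; apply/and3P; split.
  + rewrite /opening_in cat_path (@path_seg f1) => [|i _]; last by rewrite /adjn /=; lia.
    by rewrite (last_seg f1) (@path_seg f2) // => i _; rewrite /adjn /=; lia.
  + rewrite last_cat (last_seg f1) (last_seg f2) map_cons path_consE; apply/andP; split.
      by rewrite /adjn /=; lia.
    by apply: path_map_homo Pr => v w; rewrite /adjn /=; lia.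
  + rewrite map_cons last_cons last_map Lr /opening_out E3 cat_path path_consE last_cons.
    rewrite (last_seg f3) E4; apply/andP; split; first (apply/andP; split).
    * by rewrite /adjn /=; lia.
    * by apply: path_seg => i _; rewrite /adjn /=; lia.
    * by apply: path_seg => i _; rewrite /adjn /=; lia.
- have Uin : uniq (origin :: opening_in x y).
    rewrite -cat_cons cat_uniq (@uniq_seg f1) => [|i j _ _ []//].
    have U2 : uniq (seg f2 x) by have /andP[] := @uniq_seg f2 x (fun i j _ _ H => congr1 fst H).
    rewrite U2 andbT; apply/hasPn => v /mem_seg[i Hi ->];
      apply/negP => /(@mem_cons_seg f1)[j _ []]; lia.
  have Uout : uniq (opening_out L x y).
    rewrite /opening_out E3 cat_uniq uniq_seg => [|i j _ _ []]; last lia.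
    have U4 : uniq (seg f4 (L.+1 - y)).
      by have /andP[] := @uniq_seg f4 (L.+1 - y) (fun i j _ _ H => addnI (congr1 snd H)).
    rewrite U4 andbT; apply/hasPn => v /mem_seg[i Hi ->]; apply/negP => /mem_cons_seg[j _ []];
      lia.
  rewrite /opening -cat_cons cat_uniq Uin cat_uniq map_inj_uniq ?Ur ?Uout ?andbT ?andTb;
    last exact: shift11_inj.
  apply/andP; split; apply/hasPn => v.
    rewrite mem_cat inE negb_or => /orP[/shP|/outP] [A B D]; apply/andP; split.
    * by apply/eqP => E; move: A; rewrite E.
    * by apply/negP => /inP[]; lia.
    * by apply/eqP => E; move: A; rewrite E.
    * by apply/negP => /inP[]; lia.
  by move=> /outP[A B D]; apply/negP => /shP[]; lia.
- rewrite /opening /opening_out E3 !last_cat last_cons (last_seg f3) E4 (last_seg f4).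
  by rewrite /f4 xpair_eqE; lia.
- rewrite /opening all_cat [all _ (map _ _ ++ _)]all_cat; apply/and3P; split; apply/allP => v.
  + by case: v => a b /inP[/= A B _ _]; rewrite /inbox /=; lia.
  + by case: v => a b /shP[/= A B _]; rewrite /inbox /=; lia.
  + by case: v => a b /outP[/= A B _]; rewrite /inbox /=; lia.
Qed.

(** The factor [#|vertex L|] records the lowest vertex; once it is known, the opened walk determines
    the polygon by [opening_inj]. *)
Lemma P_le_nsaw L : P L <= #|vertex L| * nsaw L.+2 L.+1.
Proof.
have /choice[f Hf] : forall E, exists ur : vertex L * seq (vertex L), E \in polygons L ->
  let: (u, r) := ur in
  [/\ E = cycle_edges (u :: r), uniq (u :: r), path (@square_adj L) u r,
      to_point (last u r) = ((u.1).+1, u.2 : nat)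
    & forall v, v \in r -> u.2 < v.2 \/ (u.2 = v.2 :> nat /\ u.1 < v.1)].
  move=> E; have [/polygon_lowest[ur H]|H] := boolP (E \in polygons L); first by exists ur.
  by exists (corner00 L, [::]).
pose g E := let: (u, r) := f E in (u, opening L u.1 u.2 (map (@to_point L L) r)).
rewrite /P cardE cardE -size_walks -(size_allpairs pair) -(size_map g); apply: uniq_leq_size.
  rewrite map_inj_in_uniq ?enum_uniq // => E E'; rewrite !mem_enum => /Hf + /Hf.
  rewrite /g; case: (f E) => u r; case: (f E') => u' r' [-> _ _ _ _] [-> _ _ _ _].
  move=> H; have Eu := congr1 fst H; rewrite /= in Eu; subst u'.
  by have /opening_inj/(inj_map (@to_point_inj L L)) -> := congr1 snd H.
move=> _ /mapP[E + ->]; rewrite mem_enum => /Hf; rewrite /g; case: (f E) => u r /=.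
move=> [_ Ur Pr Lr Hr]; apply: allpairs_f; rewrite ?mem_enum // mem_walks.
have Eu : ((u.1 : nat, u.2 : nat) : point) = to_point u by [].
apply: saw_opening; rewrite ?Eu -?map_cons.
- by rewrite path_map -(eq_path (@square_adjE L)).
- by rewrite (map_inj_uniq (@to_point_inj L L)).
- by apply/allP => _ /mapP[v _ ->]; apply: inbox_to_point.
- by rewrite last_map Lr.
- by move=> _ /mapP[v /Hr + ->] => -[->//|[/= -> ->]]; rewrite eqxx orbT.
Qed.

(** * Growth *)

(** The shift by 3 absorbs the columns added by a cut: [nsaw_cut] reads as exact submultiplicativity
    of the map from [n] to [nsaw n.+3 h]. *)
Lemma nsaw_sub k n h : nsaw (k.+1 * n).+3 h <= nsaw n.+3 h ^ k.+1.
Proof.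
elim: k => [|k IH]; first by rewrite mul1n expn1.
rewrite expnSr; apply: leq_trans (leq_mul IH (leqnn _)).
have := nsaw_cut (k.+1 * n).+1 n.+1 h.
by rewrite (_ : _.+1 + _ = (k.+2 * n).+2) //; lia.
Qed.

Lemma nsaw_sub_square k n : nsaw (k.+1 * n).+3 (k.+1 * n).+3 <= nsaw n.+3 n.+3 ^ (k.+1 * k.+1).
Proof.
apply: leq_trans (nsaw_sub _ _ _) _.
by rewrite expnM leq_exp2r // nsawC nsaw_sub.
Qed.

(** Each of the [k] gluings of a further box of side [n] widens the result by [n + 2]. *)
Lemma nsaw_super k n h : nsaw n h ^ k.+1 <= nsaw (k * n.+2 + n) h.
Proof.
elim: k => [|k IH]; first by rewrite expn1.
rewrite expnSr; apply: leq_trans (leq_mul IH (leqnn _)) _.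
apply: leq_trans (nsaw_glue _ _ _) _.
by rewrite (_ : (_ + _ + n).+2 = k.+1 * n.+2 + n) //; lia.
Qed.

Lemma nsaw_super_square k n : nsaw n n ^ (k.+1 * k.+1) <= nsaw (k * n.+2 + n) (k * n.+2 + n).
Proof.
rewrite expnM; apply: leq_trans (nsaw_super _ _ _).
by rewrite leq_exp2r // nsawC; apply: leq_trans (nsaw_super k _ _) _; rewrite nsawC.
Qed.

Lemma leq_nsaw_mono a b h : a <= b -> nsaw a h <= nsaw b h.
Proof.
by move=> /subnKC <-; elim: (b - a) => [|m IH];
  rewrite ?addn0 ?addnS // (leq_trans IH) // nsaw_mono.
Qed.

Lemma leq_nsaw_mono2 m n : m <= n -> nsaw m m <= nsaw n n.
Proof. by move=> mn; apply: leq_trans (leq_nsaw_mono _ mn) _; rewrite nsawC leq_nsaw_mono. Qed.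

Lemma nsaw4_le h : nsaw 4 h <= nsaw 4 4 ^ h.+1.
Proof.
apply: leq_trans (_ : nsaw 4 h.+4 <= _); first by rewrite nsawC (nsawC 4) leq_nsaw_mono //; lia.
by rewrite nsawC; have := nsaw_sub h 1 4; rewrite muln1.
Qed.

(** One cut in each direction splits off a strip of side 4, and [nsaw4_le] cuts the strips into
    small squares: [(n + 4) + (n + 3)] factors in all. Thus one unit of side changes the logarithm
    by [O(n)]. *)
Lemma nsaw_slow n : nsaw n.+3 n.+3 <= nsaw n.+2 n.+2 * nsaw 4 4 ^ (n.*2 + 7).
Proof.
have H h : nsaw n.+3 h <= nsaw n.+2 h * nsaw 4 4 ^ h.+1.
  apply: leq_trans (leq_mul (leqnn _) (nsaw4_le h)).
  by have := nsaw_cut n 2 h; rewrite addn2.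
apply: leq_trans (H _) _; rewrite [nsaw n.+2 _]nsawC.
apply: leq_trans (leq_mul (H _) (leqnn _)) _.
by rewrite -mulnA -expnD (_ : _ + _ = n.*2 + 7) //; lia.
Qed.

(* Imported only here: [all_analysis] shadows [seq.filter]. *)
From mathcomp Require Import all_order all_classical all_reals all_analysis ring lra.

Import Order.TTheory GRing.Theory Num.Theory.
Import numFieldNormedType.Exports.

Local Open Scope classical_set_scope.
Local Open Scope ring_scope.

(** Estimating [F (m * n)] from [F m] and from [F n] shows that the intervals of centre [u n] and
    radius [A / n] meet pairwise. Hence they have a common point [l], the supremum of their left
    ends, which gives the limit together with its rate. *)
Lemma quadratic_growth (R : realType) (F : nat -> R) (A : R) : 0 <= A ->
  (forall n k, (3 < n)%N -> (0 < k)%N ->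
     `|F (k * n)%N - k%:R ^+ 2 * F n| <= A * k%:R ^+ 2 * n%:R) ->
  exists l : R, (forall n, (3 < n)%N -> `|F n - l * n%:R ^+ 2| <= A * n%:R) /\
    (fun n => F n / n%:R ^+ 2) @ \oo --> l.
Proof.
move=> A0 H; pose u n := F n / n%:R ^+ 2.
have n0 n : (3 < n)%N -> 0 < n%:R :> R by rewrite ltr0n; lia.
have key m n : (3 < m)%N -> (3 < n)%N -> u n - A / n%:R <= u m + A / m%:R.
  move=> Hm Hn; have m_gt0 := n0 _ Hm; have n_gt0 := n0 _ Hn.
  have := H m n Hm (ltn_trans _ Hn); have := H n m Hn (ltn_trans _ Hm).
  rewrite mulnC => /(_ isT)/ler_normlP[H1 H2] /(_ isT)/ler_normlP[H3 H4].
  have : m%:R ^+ 2 * F n - n%:R ^+ 2 * F m <= A * m%:R ^+ 2 * n%:R + A * n%:R ^+ 2 * m%:R by lra.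
  rewrite -subr_ge0 => K; rewrite -subr_ge0 /u.
  suff -> : F m / m%:R ^+ 2 + A / m%:R - (F n / n%:R ^+ 2 - A / n%:R) =
    (A * m%:R ^+ 2 * n%:R + A * n%:R ^+ 2 * m%:R - (m%:R ^+ 2 * F n - n%:R ^+ 2 * F m)) / (m%:R
      ^+ 2 * n%:R ^+ 2).
    by apply: divr_ge0 => //; rewrite mulr_ge0 ?sqr_ge0.
  by field; rewrite !lt0r_neq0.
pose S := [set u n - A / n%:R | n in [set n | (3 < n)%N]].
have S0 : S !=set0 by exists (u 4 - A / 4%:R); exists 4.
have Sub m : (3 < m)%N -> ubound S (u m + A / m%:R).
  by move=> Hm _ [n /= Hn <-]; apply: key.
pose l := sup S.
have lP n : (3 < n)%N -> `|u n - l| <= A / n%:R.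
  move=> Hn; have L1 : u n - A / n%:R <= l.
    by apply: ub_le_sup; [exists (u n + A / n%:R); apply: Sub|exists n].
  have L2 : l <= u n + A / n%:R by apply: ge_sup => //; apply: Sub.
  by apply/ler_normlP; split; lra.
exists l; split.
  move=> n Hn; have n_gt0 := n0 _ Hn; have := lP n Hn.
  rewrite -(ler_pM2r (exprn_gt0 2 n_gt0)) -[X in _ * X <= _](ger0_norm (sqr_ge0 _)) -normrM /u.
  rewrite (_ : (_ - l) * _ = F n - l * n%:R ^+ 2); last by field; rewrite lt0r_neq0.
  by rewrite (_ : A / _ * _ = A * n%:R) //; field; rewrite lt0r_neq0.
apply/cvgrPdist_le => e e0; near=> n.
have Hn : (3 < n)%N by near: n; exists 4%N.
rewrite distrC; apply: le_trans (lP n Hn) _.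
rewrite ler_pdivrMr ?n0 // mulrC -ler_pdivrMr //.
by near: n; exact: nbhs_infty_ger.
Unshelve. all: by end_near.
Qed.

(** * Logarithms of the walk counts *)

Section Logs.
Variable R : realType.

Let F n : R := ln (nsaw n n)%:R.
Let d : R := ln (nsaw 4 4)%:R.

Lemma nsaw_pos a h : 0 < (nsaw a h)%:R :> R. Proof. by rewrite ltr0n nsaw_gt0. Qed.

Lemma ln_nat_le m n : (0 < m)%N -> (m <= n)%N -> ln m%:R <= ln n%:R :> R.
Proof. by move=> m0 mn; rewrite ler_ln ?posrE ?ltr0n ?ler_nat // (leq_trans m0). Qed.

Lemma logc_ge0 n : 0 <= F n.
Proof. by rewrite /F ln_ge0 // ler1n nsaw_gt0. Qed.

Lemma logc_mono m n : (m <= n)%N -> F m <= F n.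
Proof. by move=> mn; apply: ln_nat_le; rewrite ?nsaw_gt0 ?leq_nsaw_mono2. Qed.

Lemma logc_slow n : (1 < n)%N -> F n.+1 <= F n + (2 * n%:R + 3) * d.
Proof.
case: n => [|[|n]] // _; have := ln_nat_le (nsaw_gt0 _ _) (nsaw_slow n).
rewrite natrM lnM ?posrE ?natrX ?exprn_gt0 ?nsaw_pos // lnXn ?nsaw_pos // => H.
apply: le_trans H _; rewrite lerD2l -[ln _ *+ _]mulr_natl ler_wpM2r ?logc_ge0 //.
by rewrite natrD -muln2 natrM -(addn2 n) natrD; lra.
Qed.

Lemma logc_sub k n : (0 < k)%N -> (2 < n)%N -> F (k * (n - 3) + 3)%N <= k%:R ^+ 2 * F n.
Proof.
case: k n => // k [|[|[|n]]] // _ _; rewrite -addn3 addnK addn3.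
have := ln_nat_le (nsaw_gt0 _ _) (nsaw_sub_square k n).
by rewrite natrX lnXn ?nsaw_pos // -[ln _ *+ _]mulr_natl natrM expr2 addn3.
Qed.

Lemma logc_super k n : (0 < k)%N -> k%:R ^+ 2 * F n <= F (k * n.+2)%N.
Proof.
case: k => // k _; have X : (0 < nsaw n n ^ (k.+1 * k.+1))%N by rewrite expn_gt0 nsaw_gt0.
have := ln_nat_le X (nsaw_super_square k n).
rewrite natrX lnXn ?nsaw_pos // -[ln _ *+ _]mulr_natl natrM -expr2 => H.
by apply: le_trans H _; apply: logc_mono; lia.
Qed.

(** Above, [F (k * n)] is at most [k ^ 2] times [F (n + 3)]; below, it is at least [k ^ 2] times
    [F (n - 2)]. Three slow steps cost [(6 n + 15) d], at most [14 n d], and two cost [4 n d]. *)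
Lemma logc_homogeneous n k : (3 < n)%N -> (0 < k)%N ->
  `|F (k * n)%N - k%:R ^+ 2 * F n| <= (14 * d) * k%:R ^+ 2 * n%:R.
Proof.
move=> n3 k0; have d0 : 0 <= d := logc_ge0 4; have k2 : 0 <= k%:R ^+ 2 :> R by apply: sqr_ge0.
have n4 : 4 <= n%:R :> R by rewrite (ler_nat R 4).
have nd : 4 * d <= n%:R * d by rewrite ler_wpM2r.
have up : F (k * n)%N <= k%:R ^+ 2 * (F n + 14 * n%:R * d).
  have H : F n.+3 <= F n + 14 * n%:R * d.
    have H1 := @logc_slow n (ltn_trans (isT : (1 < 3)%N) n3).
    have H2 := @logc_slow n.+1 (ltn_trans (isT : (0 < 3)%N) n3); have H3 := @logc_slow n.+2 isT.
    rewrite -(natr1 n) in H2; rewrite -(natr1 n.+1) -(natr1 n) in H3.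
    by clear -H1 H2 H3 nd d0; nra.
  apply: le_trans (ler_wpM2l k2 H); apply: le_trans (@logc_sub k n.+3 k0 _) => //.
  by apply: logc_mono; rewrite -addn3 addnK leq_addr.
have lo : k%:R ^+ 2 * (F n - 4 * n%:R * d) <= F (k * n)%N.
  case: n n3 n4 nd {up} => [|[|n]] // n3 n4 nd.
  apply: le_trans (logc_super n k0); apply: ler_wpM2l => //.
  have H1 := @logc_slow n n3; have H2 := @logc_slow n.+1 (ltnW n3).
  rewrite -(natr1 n) in H2; rewrite -(natr1 n.+1) -(natr1 n) in n4 nd *.
  by clear -H1 H2 nd d0; nra.
apply/ler_normlP; split; nra.
Qed.

End Logs.

(** [ln (P L)] lies between [F (L - 1)] and [F (L + 2) + 2 ln (L + 1)]. Moving the sides back to [L]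
    costs at most [(4 L + 8) d], which is at most [6 L d] for [L] at least 4, and [ln (L + 1)] is at
    most [L]. *)
Lemma logP_logc (R : realType) L : (3 < L)%N ->
  `|ln (P L)%:R - ln (nsaw L L)%:R| <= (2 + 6 * ln (nsaw 4 4)%:R) * L%:R :> R.
Proof.
case: L => [|[|L]] // L3; set F := fun n => ln (nsaw n n)%:R : R; set d := ln (nsaw 4 4)%:R : R.
have d0 : 0 <= d := logc_ge0 R 4.
have n4 : 4 <= L.+2%:R :> R by rewrite (ler_nat R 4).
have S1 : L.+1%:R = L.+2%:R - 1 :> R by rewrite -(natr1 L.+1); lra.
have S3 : L.+3%:R = L.+2%:R + 1 :> R by rewrite -(natr1 L.+2).
have nd : 4 * d <= L.+2%:R * d by rewrite ler_wpM2r.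
have lo : F L.+1 <= ln (P L.+2)%:R by apply: ln_nat_le; rewrite ?nsaw_gt0 ?nsaw_le_P.
have P0 : (0 < P L.+2)%N by apply: leq_trans (nsaw_le_P L.+1); apply: nsaw_gt0.
have up : ln (P L.+2)%:R <= 2 * L.+2%:R + F L.+4.
  have H : (P L.+2 <= L.+3 ^ 2 * nsaw L.+4 L.+4)%N.
    apply: leq_trans (P_le_nsaw L.+2) _; rewrite card_prod card_ord mulnn leq_mul2l.
    by rewrite [nsaw _ L.+3]nsawC nsaw_mono orbT.
  apply: le_trans (ln_nat_le R P0 H) _.
  rewrite natrM lnM ?posrE ?nsaw_pos ?natrX ?exprn_gt0 ?ltr0n // lnXn ?ltr0n //.
  rewrite lerD2r -[ln _ *+ _]mulr_natl ler_wpM2l // -(natr1 L.+2) addrC.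
  by apply: le_ln1Dx; lra.
have H1 : F L.+3 <= F L.+2 + (2 * L.+2%:R + 3) * d by apply: logc_slow.
have H2 : F L.+4 <= F L.+3 + (2 * L.+3%:R + 3) * d by apply: logc_slow.
have H0 : F L.+2 <= F L.+1 + (2 * L.+1%:R + 3) * d by apply: logc_slow; lia.
rewrite S1 in H0; rewrite S3 in H2; rewrite -/(F L.+2).
apply/ler_normlP; split; clear -lo up H0 H1 H2 n4 nd d0; nra.
Qed.

Theorem theorem3 (R : realType) :
  exists (r : nat -> R) (K : R), \forall L \near \oo,
    ln (P L)%:R = (L%:R ^+ 2 + r L) * ln (lambda R) /\
    `|r L| <= K * L%:R.
Proof.
pose F n : R := ln (nsaw n n)%:R; pose d : R := ln (nsaw 4 4)%:R.
have d0 : 0 <= d := logc_ge0 R 4.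
have A0 : 0 <= 14 * d by apply: mulr_ge0.
have [l [Hl lim_l]] := quadratic_growth A0 (@logc_homogeneous R).
have F1 : 0 < F 1 by apply: ln_gt0; rewrite ltr1n nsaw11.
have l0 : 0 < l.
  (* Unit squares, each taking side 3 after gluing, give [k ^ 2 * F 1 <= F (3 k)]; comparison with
     [l * (3 k) ^ 2], divided by [k], gives this bound. It fails for large [k] if [l] is not
     positive. *)
  have H k : (1 < k)%N -> k%:R * F 1 <= 9 * k%:R * l + 3 * (14 * d).
    move=> k1; have k0 : 0 < k%:R :> R by rewrite ltr0n; lia.
    have /ler_normlP[_ U] : `|F (k * 3)%N - l * (k * 3)%:R ^+ 2| <= 14 * d * (k * 3)%:R.
      by apply: Hl; lia.
    have := @logc_super R k 1 (ltnW k1); rewrite -/(F 1) -/(F (k * 3)%N) => L.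
    rewrite natrM in U; rewrite -(ler_pM2l k0).
    by clear -U L; nra.
  rewrite ltNge; apply/negP => ln0.
  have [k Hk] : exists k : nat, 3 * (14 * d) / F 1 < k%:R.
    by exists (Num.bound (3 * (14 * d) / F 1)); apply: archi_boundP;
      rewrite divr_ge0 ?mulr_ge0 // ltW.
  have := H k.+2 isT; have k0 : 0 <= k%:R :> R by [].
  rewrite ltr_pdivrMr // in Hk; rewrite -(natr1 k.+1) -(natr1 k).
  by clear -Hk ln0 F1 k0; nra.
(* The convergence just proved identifies the [limn] in [lambda] as a genuine limit. *)
have lnlambda : ln (lambda R) = l.
  rewrite /lambda expRK; apply/cvg_lim => //; move: lim_l.
  by rewrite (_ : (fun n => _) = @log_lambda_seq R) //; apply/funext => n;
    rewrite /log_lambda_seq C_nsaw.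
(* The remainder is solved from the required identity, which is possible as [l] is positive. [K]
   adds the errors of walks against [l * L ^ 2] and of polygons against walks, divided by [l]. *)
exists (fun L => ln (P L)%:R / l - L%:R ^+ 2), ((14 * d + (2 + 6 * d)) / l).
exists 4%N => // L /= L4; rewrite lnlambda; split.
  by rewrite addrC subrK divfK // gt_eqF.
rewrite -(ler_pM2r l0) -[X in _ * X <= _](gtr0_norm l0) -normrM mulrBl divfK ?gt_eqF //.
rewrite [leRHS]mulrAC divfK ?gt_eqF // mulrDl.
have -> : ln (P L)%:R - L%:R ^+ 2 * l = (F L - l * L%:R ^+ 2) + (ln (P L)%:R - F L) by ring.
apply: le_trans (ler_normD _ _) _; apply: lerD; first exact: Hl.
exact: logP_logc.
Qed.
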